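(* Let $a,b,c\in\mathbb Z$, $f(i,j)=ai^2+bij+cj^2$, $\Delta=b^2-4ac$ and $\sigma=a+b+c$. For a prime $p>3$ put $$P(p)=\prod_{\substack{0<i<j<p/2\\ p\nmid f(i,j)}}\Big(\frac{f(i,j)}{p}\Big)\qquad (i,j\in\mathbb Z).$$ (i) Consider primes $p>3$ with $p\nmid c\sigma$, and for such $p$ let $k=k(p)$ be the least positive integer with $4c\sigma k\equiv-\Delta\pmod p$. Let $S(p)$ be the least nonnegative residue modulo $16$ of $\sum_{y=1}^{p-1}\big(\frac{y(y+1)(y+k)}{p}\big)$. Then $P$ and $S$ are equivalent as functions of $p$. (ii) If $f(i,j)=(mi+nj)(ui+vj)$ with $m,n,u,v\in\mathbb Z$, then $P(p)$ (for primes $p>3$) is a periodic function of $p$.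
   Context: $\big(\frac{\cdot}{p}\big)$ is the Legendre symbol; the product runs only over pairs of integers with $0<i<j<p/2$ and $p\nmid f(i,j)$ (an empty product is $1$). A function $g$ defined on a set of primes is called periodic if there is $m\in\mathbb Z_{>0}$ such that $g(p_1)=g(p_2)$ whenever $p_1,p_2$ are in its domain and $p_1\equiv p_2\pmod m$. Two functions $g,h$ defined on sets of primes are called equivalent if there is $m\in\mathbb Z_{>0}$ such that for each residue $r$ with $1\le r<m$, $\gcd(r,m)=1$, there is a polynomial $f_r$ of degree one with rational coefficients such that $g(p)=f_r(h(p))$ for every prime $p$ in the common domain of $g$ and $h$ with $p\equiv r\pmod m$. *)

(* Defs.v *)
From mathcomp Require Import all_boot all_order all_algebra.

Set Implicit Arguments.
Unset Strict Implicit.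
Unset Printing Implicit Defensive.

Import GRing.Theory.
Local Open Scope ring_scope.

Definition legendre (x : int) (p : nat) : int :=
  if (p %| x)%Z then 0
  else if [exists y : 'I_p, (x == (y : nat)%:Z ^+ 2 %[mod p])%Z] then 1
  else -1.

Definition qform (a b c i j : int) : int := a * i ^+ 2 + b * i * j + c * j ^+ 2.

Definition Pprod (a b c : int) (p : nat) : int :=
  \prod_(1 <= j < p | (2 * j < p)%N)
    \prod_(1 <= i < j | ~~ (p %| qform a b c i j)%Z)
      legendre (qform a b c i j) p.

Definition primes_gt3 : pred nat := fun p => prime p && (3 < p)%N.

Definition primes_gt3_ndvd (x : int) : pred nat :=
  fun p => primes_gt3 p && ~~ (p %| x)%Z.

Definition is_least_positive (Q : nat -> Prop) (k : nat) : Prop :=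
  [/\ (0 < k)%N, Q k & forall l : nat, (0 < l)%N -> Q l -> (k <= l)%N].

(* [modz] by 16 is the least nonnegative residue. *)
Definition Sres (k : nat -> nat) (p : nat) : int :=
  ((\sum_(1 <= y < p)
      legendre (y%:Z * (y%:Z + 1) * (y%:Z + (k p)%:Z)) p) %% 16)%Z.

(* A function defined on a set of primes is a total function on [nat] together
   with its domain [D]; its values outside [D] are irrelevant. *)
Definition periodic (T : Type) (D : pred nat) (g : nat -> T) : Prop :=
  exists2 m : nat, (0 < m)%N &
    forall p1 p2 : nat, D p1 -> D p2 -> p1 = p2 %[mod m] -> g p1 = g p2.

(* [m = 1] is excluded: no [r] satisfies [1 <= r < 1], so it would make any two
   functions equivalent. *)
Definition equivalent (Dg : pred nat) (g : nat -> int)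
    (Dh : pred nat) (h : nat -> int) : Prop :=
  exists2 m : nat, (1 < m)%N &
    forall r : nat, (1 <= r < m)%N -> coprime r m ->
      exists2 f : {poly rat}, size f = 2%N &
        forall p : nat, Dg p -> Dh p -> p = r %[mod m] ->
          (g p)%:~R = f.[(h p)%:~R].

(* Main.v *)
(* Write p = 2n + 1, chi for the quadratic character of F_p, eps = chi(-2),
   B = b + 2c, g = 4 c sigma (so Delta = B^2 - g) and Q(x) = c x^2 + B x + sigma.

   As chi(f(i,j)) depends only on t = i/j, P(p) is the product over t of
   chi(f(t,1)) raised to the number of j <= n with 0 < (t j mod p) < j.  By
   Gauss's lemma for t and 1 - t this number has sign eps chi(t) chi(1 - t), so
   with t = 1/(1 + x), P(p) is, up to the factor at x = -1, the product of
   chi(Q(x)) over the x with chi(x) = -eps, that is (-1)^N where 4N is given by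
   elementary character sums and E = sum_x chi(x Q(x)).

   In (i), E = sum_w chi(w^2 - g) chi(B + w), whereas chi(g) S(p) is essentially
   sum_w chi(w^2 - g) chi(w^2 - B^2).  Both sums occur in the expansion of
   sum_w (1 - chi(w^2 - g)) (1 + chi(B + w)) (1 + chi(B - w)), which is 8 times
   an even number up to boundary terms, by the symmetry w -> -w.  Modulo 16
   this makes 8N + (sign) S(p) a function of Legendre symbols of fixed integers,
   which are periodic in p by Gauss's lemma.  In (ii), Q is a product of two
   linear forms, and for linear Q the sum E is elementary. *)

Require Import Defs.
From mathcomp Require Import all_boot all_order all_algebra.
From mathcomp Require Import all_field zify ring lra.
From Stdlib Require Import Classical_Prop.

Set Implicit Arguments.
Unset Strict Implicit.
Unset Printing Implicit Defensive.

Import Order.TTheory GRing.Theory Num.Theory.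
Local Open Scope ring_scope.


(** * The quadratic character of a finite field *)

Section QuadraticCharacter.

Variable F : finFieldType.
Implicit Types x y z t a b : F.

Definition chi x : int :=
  if x == 0 then 0 else if [exists y : F, x == y ^+ 2] then 1 else -1.

Lemma chi0 : chi 0 = 0. Proof. by rewrite /chi eqxx. Qed.

Lemma chi_eq0 x : (chi x == 0) = (x == 0).
Proof. by rewrite /chi; case: (x == 0) => //; case: ([exists y, x == y ^+ 2]). Qed.

Lemma chi_sqr x : x != 0 -> chi (x ^+ 2) = 1.
Proof.
move=> x0; rewrite /chi sqrf_eq0 (negPf x0).
by case: ifP => // /existsP []; exists x.
Qed.

Lemma chi1 : chi 1 = 1.
Proof. by have := @chi_sqr 1; rewrite expr1n oner_eq0; apply. Qed.

Variant chi_spec x : int -> bool -> Type :=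
| ChiZero of x = 0 : chi_spec x 0 true
| ChiSquare y of x = y ^+ 2 & y != 0 : chi_spec x 1 false
| ChiNonsquare of (forall y, x != y ^+ 2) : chi_spec x (-1) false.

Lemma chiP x : chi_spec x (chi x) (x == 0).
Proof.
rewrite /chi; case: eqP => [x0|/eqP x0]; first by constructor.
case: ifP => [/existsP/sigW [y /eqP xy]|/existsP nx].
  apply: (@ChiSquare x y) => //; apply: contraNneq x0 => y0.
  by rewrite xy y0 expr0n.
by constructor => y; apply/negP => xy; apply: nx; exists y.
Qed.

Lemma chi_cases x : x != 0 -> (chi x == 1) || (chi x == -1).
Proof. by case: chiP. Qed.

Lemma chi_squared x : x != 0 -> chi x * chi x = 1.
Proof. by case: chiP. Qed.

Hypothesis two_neq0 : 2 != 0 :> F.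

Lemma addrr_neq0 x : x != 0 -> x + x != 0.
Proof. by move=> x0; rewrite -mulr2n -mulr_natl mulf_neq0. Qed.

Lemma opp_neq x : x != 0 -> - x != x.
Proof.
by move=> x0; rewrite eq_sym -subr_eq0 opprK addrr_neq0.
Qed.

Lemma card_sqrt a : (#|[set x | x ^+ 2 == a]|%:Z = 1 + chi a).
Proof.
case: chiP => [->|y -> y0|ny].
- have -> : [set x | x ^+ 2 == 0 :> F] = [set 0].
    by apply/setP => x; rewrite !inE sqrf_eq0.
  by rewrite cards1.
- have -> : [set x | x ^+ 2 == y ^+ 2] = [set y; - y].
    by apply/setP => x; rewrite !inE eqf_sqr.
  by rewrite cards2 eq_sym opp_neq.
- have -> : [set x | x ^+ 2 == a] = set0.
    by apply/setP => x; rewrite !inE eq_sym; apply/negbTE.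
  by rewrite cards0.
Qed.

Lemma sum_fiber (h : F -> F) (G : F -> int) :
  \sum_x G (h x) = \sum_v #|[set x | h x == v]|%:Z * G v.
Proof.
rewrite (partition_big h predT) //=; apply: eq_bigr => v _.
rewrite (eq_bigr (fun=> G v)) => [|x /eqP -> //].
by rewrite sumr_const -mulr_natl cardsE natz.
Qed.

Lemma sum_sqr (G : F -> int) : \sum_x G (x ^+ 2) = \sum_v (1 + chi v) * G v.
Proof.
by rewrite (sum_fiber (fun x => x ^+ 2)); apply: eq_bigr => v _; rewrite card_sqrt.
Qed.

Lemma sum_one : \sum_(x : F) 1 = #|F|%:Z.
Proof. by rewrite sumr_const natz. Qed.

Lemma sum_chi : \sum_x chi x = 0.
Proof.
have := sum_sqr (fun=> 1); rewrite sum_one.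
under [in RHS]eq_bigr do rewrite mulr1.
by rewrite big_split /= sum_one -[LHS]addr0 => /addrI.
Qed.

Lemma chi_sqrM x y : y != 0 -> chi (y ^+ 2 * x) = chi x.
Proof.
move=> y0; case: (chiP x) => [->|z -> z0|nz].
- by rewrite mulr0 chi0.
- by rewrite -exprMn chi_sqr // mulf_neq0.
case: chiP => // [/eqP|z yz].
  rewrite mulf_eq0 sqrf_eq0 (negPf y0) /= => /eqP x0.
  by have := nz 0; rewrite x0 expr0n eqxx.
by case/eqP: (nz (z / y)); rewrite expr_div_n -yz mulrC mulKf // sqrf_eq0.
Qed.

(** Multiplicativity follows by counting: for a nonsquare [x] each [chi (x * z) + chi z] is at most
    0, while these terms add up to 0 over all [z], so every one of them vanishes. *)
Lemma chiM x y : chi (x * y) = chi x * chi y.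
Proof.
case: (chiP x) => [->|z -> z0|nx]; first by rewrite mul0r chi0 mul0r.
  by rewrite mul1r chi_sqrM.
have x0 : x != 0 by have := nx 0; rewrite expr0n.
have sx b : b != 0 -> chi (x * b ^+ 2) = -1.
  by move=> b0; rewrite mulrC chi_sqrM //; case: chiP nx => // [->|b' -> _] nx;
     [case/eqP: (nx 0); rewrite expr0n | case/eqP: (nx b')].
have le0 z : chi (x * z) + chi z <= 0.
  case: (chiP z) => [->|b -> b0|nz]; first by rewrite mulr0 chi0.
    by rewrite sx.
  by case: (chiP (x * z)).
have : \sum_z (chi (x * z) + chi z) == 0.
  rewrite big_split /= sum_chi addr0.
  rewrite -(reindex (fun z => x * z) (F := chi) (P := xpredT)) /= ?sum_chi //.
  by exists (fun z => x^-1 * z) => z _; rewrite ?mulKf ?mulVKf.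
rewrite -oppr_eq0 -sumrN psumr_eq0 => [|z _]; last by rewrite oppr_ge0.
move/allP/(_ y (mem_index_enum y)); rewrite /= oppr_eq0 addr_eq0 => /eqP ->.
by rewrite mulN1r.
Qed.

Lemma chiV x : chi x^-1 = chi x.
Proof.
have [->|x0] := eqVneq x 0; first by rewrite invr0.
by rewrite -(@chi_sqrM x^-1 x) // expr2 -mulrA divff // mulr1.
Qed.

Lemma chi_div x y : chi (x / y) = chi (x * y).
Proof. by rewrite !chiM chiV. Qed.

Lemma sum_affine a b (G : F -> int) : a != 0 ->
  \sum_x G (a * x + b) = \sum_x G x.
Proof.
move=> a0; rewrite [RHS](reindex (fun x => a * x + b)) //.
exists (fun x => (x - b) / a) => x _; first by rewrite addrK mulrC mulKf.
by rewrite mulrC divfK // subrK.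
Qed.

Lemma sum_chi_sqr_sub d :
  \sum_x chi (x ^+ 2 - d) = if d == 0 then #|F|%:Z - 1 else -1.
Proof.
rewrite (sum_sqr (fun v => chi (v - d))).
case: eqP => [->|/eqP d0].
  under eq_bigr do rewrite subr0.
  rewrite (bigD1 0) //= chi0 mulr0 add0r.
  rewrite (eq_bigr (fun x => 1 + chi x)) => [|x x0]; last first.
    by rewrite mulrDl mul1r chi_squared // addrC.
  rewrite -sum_one [in RHS](bigD1 0) //= addrAC subrr add0r big_split /=.
  by move: sum_chi; rewrite (bigD1 0) //= chi0 add0r => ->; rewrite addr0.
under eq_bigr do rewrite mulrDl mul1r.
rewrite big_split /=.
have -> : \sum_v chi (v - d) = 0.
  rewrite -[RHS]sum_chi -[RHS](sum_affine (- d) _ (oner_neq0 F)).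
  by apply: eq_bigr => v _; rewrite mul1r.
rewrite add0r (bigD1 0) //= chi0 mul0r add0r.
(* Dividing the argument by [v ^+ 2] leaves [1 - d / v], which takes every value except 1 as [v]
   runs over the nonzero elements. The sum is therefore [0 - chi 1]. *)
rewrite (eq_bigr (fun v => chi (1 - d * v^-1))) => [|v v0]; last first.
  rewrite -chiM -(@chi_sqrM (1 - d * v^-1) v) //.
  by congr chi; field.
have nd0 : - d != 0 by rewrite oppr_eq0.
have := sum_affine 1 chi nd0.
rewrite sum_chi (reindex_inj invr_inj) (bigD1 0) //= invr0 mulr0 add0r chi1.
move/eqP; rewrite addrC addr_eq0 => /eqP <-.
by apply: eq_bigr => v _; rewrite mulNr addrC.
Qed.

Lemma four_neq0 : 4 != 0 :> F.
Proof. by rewrite (natrM _ 2 2) mulf_neq0. Qed.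

Lemma sum_chi_quadratic a b c : a != 0 ->
  \sum_x chi (a * x ^+ 2 + b * x + c) =
  chi a * (if b ^+ 2 - 4 * a * c == 0 then #|F|%:Z - 1 else -1).
Proof.
move=> a0; rewrite -sum_chi_sqr_sub mulr_sumr.
rewrite -[RHS](sum_affine b _ (a := 2 * a)) ?mulf_neq0 //.
apply: eq_bigr => x _; rewrite -chiM -(@chi_sqrM (_ + c) 2) //.
rewrite -[RHS](@chi_sqrM _ a^-1) ?invr_eq0 //.
have -> : a^-1 ^+ 2 * (a * ((2 * a * x + b) ^+ 2 - (b ^+ 2 - 4 * a * c)))
  = 2 ^+ 2 * (a * x ^+ 2 + b * x + c) by field.
by [].
Qed.

Lemma card_quadratic_roots a b c : a != 0 ->
  #|[set x | a * x ^+ 2 + b * x + c == 0]|%:Z = 1 + chi (b ^+ 2 - 4 * a * c).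
Proof.
move=> a0; rewrite -card_sqrt; congr Posz.
have a20 : 2 * a != 0 by rewrite mulf_neq0.
rewrite -(card_imset [set x | a * x ^+ 2 + b * x + c == 0]
  (f := fun x => 2 * a * x + b)); last by move=> x y /addIr/(mulfI a20).
apply: eq_card => y; rewrite !inE; apply/imsetP/eqP => [[x]|yd].
  rewrite inE => /eqP x0 ->.
  have -> : (2 * a * x + b) ^+ 2 =
    4 * a * (a * x ^+ 2 + b * x + c) + (b ^+ 2 - 4 * a * c) by ring.
  by rewrite x0 mulr0 add0r.
exists ((y - b) / (2 * a)); last by rewrite /=; field; rewrite a0.
rewrite inE; apply/eqP; apply: (mulfI (mulf_neq0 four_neq0 a0)).
rewrite mulr0 -[RHS](subrr (y ^+ 2)) [in X in _ = _ - X]yd.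
by field; rewrite a0 two_neq0.
Qed.

End QuadraticCharacter.

Arguments chi {F} x.


Lemma even_card_involution (T : finType) (f : T -> T) (A : {set T}) :
  involutive f -> {in A, forall x : T, f x \in A} ->
  {in A, forall x : T, f x != x} -> ~~ odd #|A|.
Proof.
move=> fK; have [n] := ubnP #|A|; elim: n A => // n IHn A leAn Af fA.
have [->|[x Ax]] := set_0Vmem A; first by rewrite cards0.
have cA : #|A| = #|A :\ x :\ f x|.+2.
  by rewrite (cardsD1 x) Ax (cardsD1 (f x)) !inE fA // Af.
rewrite cA /= negbK; apply: IHn => [|y|y]; first by rewrite cA in leAn; lia.
  rewrite !inE => /and3P[yfx yx Ay]; rewrite (Af y Ay) andbT; apply/andP; split.
    by apply: contraNneq yx => /(inv_inj fK) ->.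
  by apply: contraNneq yfx => <-; rewrite fK.
by rewrite !inE => /and3P[_ _ /fA].
Qed.

(** * Character sums *)

Section CharacterSums.

Variable F : finFieldType.
Implicit Types x y z t w a b c : F.
Hypothesis two_neq0 : 2 != 0 :> F.

Lemma sum_onePM (G H : F -> int) :
  \sum_x (1 + G x) * H x = \sum_x H x + \sum_x G x * H x.
Proof. by rewrite -big_split; apply: eq_bigr => x _; rewrite mulrDl mul1r. Qed.

Lemma sum_chi_affine a b :
  \sum_x chi (a * x + b) = if a == 0 then #|F|%:Z * chi b else 0.
Proof.
case: eqP => [->|/eqP a0]; last by rewrite (sum_affine _ _ a0) sum_chi.
by under eq_bigr do rewrite mul0r add0r; rewrite sumr_const -mulr_natl natz.
Qed.

(** The product of the two forms is quadratic with discriminant [(a * d - b * c) ^+ 2]. *)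
Lemma sum_chi_affineM a b c d : a * c != 0 ->
  \sum_x chi (a * x + b) * chi (c * x + d) =
  chi (a * c) * (if a * d == b * c then #|F|%:Z - 1 else -1).
Proof.
move=> ac0.
transitivity (\sum_x chi (a * c * x ^+ 2 + (a * d + b * c) * x + b * d)).
  by apply: eq_bigr => x _; rewrite -chiM //; congr chi; ring.
rewrite sum_chi_quadratic //.
have -> : (a * d + b * c) ^+ 2 - 4 * (a * c) * (b * d) = (a * d - b * c) ^+ 2.
  by ring.
by rewrite sqrf_eq0 subr_eq0.
Qed.

(* Grouping the terms by the value [w] of [c x + s / x]. *)
Lemma sum_chi_cubic (c b s : F) : c != 0 -> s != 0 ->
  \sum_x chi x * chi (c * x ^+ 2 + b * x + s) =
  \sum_w chi (w ^+ 2 - 4 * c * s) * chi (b + w).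
Proof.
move=> c0 s0.
transitivity (\sum_(x | x != 0) chi (b + (c * x + s / x))).
  rewrite (bigD1 0) //= chi0 mul0r add0r; apply: eq_bigr => x x0.
  by rewrite -chiM // -(chi_sqrM (b + _) x0); congr chi; field.
rewrite (partition_big (fun x => c * x + s / x) predT) //=.
transitivity (\sum_w (1 + chi (w ^+ 2 - 4 * c * s)) * chi (b + w)).
  apply: eq_bigr => w _.
  rewrite (eq_bigr (fun=> chi (b + w))) => [|x /andP[_ /eqP ->] //].
  rewrite sumr_const -[_ *+ _]mulr_natl natz; congr (_ * _).
  (* The [x] with [c x + s / x = w] are the roots of [c x^2 - w x + s]; none of them is 0 because
     [s != 0]. *)
  rewrite -[w ^+ 2]sqrrN -card_quadratic_roots //; congr Posz; apply: eq_card => x.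
  rewrite !inE [x \in _]unfold_in /=.
  have [->|x0] /= := eqVneq x 0.
    by rewrite expr0n /= !mulr0 !add0r (negPf s0).
  apply/eqP/eqP => [<-|xE]; first by field.
  apply: (mulIf x0); apply/eqP; rewrite -subr_eq0 -xE; apply/eqP; field; exact: x0.
rewrite sum_onePM -[RHS]add0r; congr (_ + _).
rewrite -[RHS](sum_chi two_neq0) -[RHS](sum_affine b _ (oner_neq0 F)).
by apply: eq_bigr => w _; rewrite mul1r addrC.
Qed.

(* Substitute [v = w ^ 2], then [v = g (y + 1)]. *)
Lemma sum_chi_legendre_form (b k g : F) (s : int) : g != 0 -> g * (1 - k) = b ^+ 2 ->
  s = \sum_y chi (y * (y + 1) * (y + k)) ->
  \sum_w chi (w ^+ 2 - g) * chi (b ^+ 2 - w ^+ 2) =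
  chi (-1 : F) * ((if g == b ^+ 2 then #|F|%:Z - 1 else -1) + chi g * s).
Proof.
move=> g0 kE ->.
transitivity (chi (-1 : F) * \sum_v (1 + chi v) * (chi (v - g) * chi (v - b ^+ 2))).
  rewrite -(sum_sqr two_neq0 (fun v => chi (v - g) * chi (v - b ^+ 2))) mulr_sumr.
  apply: eq_bigr => w _; rewrite mulrCA -!chiM //; congr chi; ring.
rewrite sum_onePM; congr (_ * (_ + _)).
  have := sum_chi_affineM (a := 1) (- g) (c := 1) (- b ^+ 2).
  rewrite mulr1 mul1r mulr1 eqr_opp chi1 mul1r [b ^+ 2 == g]eq_sym => <-;
    last exact: oner_neq0.
  by apply: eq_bigr => v _; rewrite mul1r.
rewrite mulr_sumr -(sum_affine g _ g0).
apply: eq_bigr => y _; rewrite -!chiM //.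
by rewrite -(chi_sqrM (g * _) g0); congr chi; rewrite -kE; ring.
Qed.

Definition sign_prod (eps : int) (h : F -> F) : int :=
  \prod_(x | (chi x == - eps) && (h x != 0)) chi (h x).

(** [N] counts the [x] with [chi x = - eps] and [chi (h x) = -1]. Where [x] and [h x] are nonzero,
    four times the indicator of this set is [(1 - eps * chi x) * (1 - chi (h x))]. The subtracted
    terms undo the extension of the sum to [x = 0] and to the zeros of [h]. *)
Lemma sign_prodE (eps : int) (h : F -> F) : eps = 1 \/ eps = -1 ->
  exists N : nat, sign_prod eps h = (-1) ^+ N /\
  4 * N%:Z = #|F|%:Z - \sum_x chi (h x) + eps * (\sum_x chi x * chi (h x))
    - (1 - chi (h 0)) - \sum_(x | (x != 0) && (h x == 0)) (1 - eps * chi x).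
Proof.
move=> epsE.
exists #|[set x | (chi x == - eps) && (chi (h x) == -1)]|; split.
  rewrite /sign_prod (bigID (fun x => chi (h x) == -1)) /=.
  rewrite [X in _ * X]big1 ?mulr1 => [|x /andP[/andP[_ hx0] /negPf hx]]; last first.
    by have := chi_cases hx0; rewrite hx orbF => /eqP.
  rewrite (eq_bigr (fun=> -1)) => [|x /andP[_ /eqP] //].
  rewrite prodr_const; congr (_ ^+ _); apply: eq_card => x.
  rewrite !inE [x \in _]unfold_in /= -andbA; congr (_ && _).
  by case: chiP.
transitivity (\sum_(x | (x != 0) && (h x != 0)) (1 - eps * chi x) * (1 - chi (h x))).
  rewrite -sum1_card rmorph_sum /= mulr_sumr [RHS]big_mkcond [LHS]big_mkcond.
  apply: eq_bigr => x _; rewrite inE.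
  by case: epsE => ->; case: (chiP x); case: (chiP (h x)).
have -> : #|F|%:Z - \sum_x chi (h x) + eps * (\sum_x chi x * chi (h x)) =
   \sum_x (1 - eps * chi x) * (1 - chi (h x)).
  have z : - eps * (\sum_(x : F) chi x) = 0 by rewrite sum_chi ?mulr0.
  rewrite -[LHS]addr0 -[X in _ + X]z -(sum_one F) !mulr_sumr -sumrB -!big_split /=.
  by apply: eq_bigr => x _; ring.
rewrite [X in _ = X - _ - _](bigD1 0) //= chi0 mulr0 subr0 mul1r.
rewrite (bigID (fun x => h x == 0) (fun x => x != 0)) /=.
rewrite [X in _ + (X + _)](eq_bigr (fun x => 1 - eps * chi x)); first by ring.
by move=> x /andP[_ /eqP ->]; rewrite chi0 subr0 mulr1.
Qed.

End CharacterSums.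


(** * The congruence modulo 16 *)

Section Congruence.

Variable F : finFieldType.
Hypothesis two_neq0 : 2 != 0 :> F.

Lemma sum_const_on (P : pred F) (G : F -> int) (v : int) :
  (forall x, P x -> G x = v) -> \sum_(x | P x) G x = #|[set x | P x]|%:Z * v.
Proof.
by move=> GE; rewrite (eq_bigr _ GE) sumr_const -mulr_natl natz cardsE.
Qed.

Variables B g : F.
Hypothesis g_neq0 : g != 0.

(** The part of [triple_sum] at [w ^+ 2 = g], where the factor [1 - chi (w ^+ 2 - g)] is 1. *)
Definition sqrt_sum : int :=
  \sum_(w | w ^+ 2 == g) (1 + chi (B + w)) * (1 + chi (B - w)).

Definition triple_sum : int :=
  \sum_w (1 - chi (w ^+ 2 - g)) * ((1 + chi (B + w)) * (1 + chi (B - w))).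

(** The reflection [w -> - w] identifies the sums containing [B - w] with those containing [B + w],
    whence the coefficient 2. *)
Lemma triple_sumE :
  triple_sum = #|F|%:Z + chi (-1 : F) * (if B == 0 then #|F|%:Z - 1 else -1) + 1
    - 2 * \sum_w chi (w ^+ 2 - g) * chi (B + w)
    - \sum_w chi (w ^+ 2 - g) * chi (B ^+ 2 - w ^+ 2).
Proof.
have sB : \sum_w chi (B + w) = 0.
  rewrite -[RHS](sum_chi two_neq0) -[RHS](sum_affine B _ (oner_neq0 F)).
  by apply: eq_bigr => w _; rewrite mul1r addrC.
have sym (G : F -> int) : \sum_w G w = \sum_w G (- w) by exact: (reindex_inj oppr_inj).
have sBm : \sum_w chi (B - w) = 0 by rewrite -(sym (fun w => chi (B + w))).
have sE : \sum_w chi (w ^+ 2 - g) * chi (B - w) =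
          \sum_w chi (w ^+ 2 - g) * chi (B + w).
  by rewrite [RHS]sym; apply: eq_bigr => w _; rewrite sqrrN.
have sG : \sum_w chi (B ^+ 2 - w ^+ 2) =
    chi (-1 : F) * (if B == 0 then #|F|%:Z - 1 else -1).
  have := sum_chi_quadratic two_neq0 0 (B ^+ 2) (a := -1).
  rewrite oppr_eq0 oner_neq0 => /(_ isT).
  have -> : (0 ^+ 2 - 4 * -1 * B ^+ 2 == 0) = (B == 0).
    have -> : 0 ^+ 2 - 4 * -1 * B ^+ 2 = (2 * B) ^+ 2 by ring.
    by rewrite sqrf_eq0 mulf_eq0 (negPf two_neq0).
  by move=> <-; apply: eq_bigr => w _; congr chi; ring.
have sF : \sum_w chi (w ^+ 2 - g) = -1.
  by rewrite sum_chi_sqr_sub // (negPf g_neq0).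
have -> : triple_sum = \sum_(w : F) 1 + \sum_w chi (B + w) + \sum_w chi (B - w)
   + \sum_w chi (B ^+ 2 - w ^+ 2) - \sum_w chi (w ^+ 2 - g)
   - \sum_w chi (w ^+ 2 - g) * chi (B + w) - \sum_w chi (w ^+ 2 - g) * chi (B - w)
   - \sum_w chi (w ^+ 2 - g) * chi (B ^+ 2 - w ^+ 2).
  rewrite -!sumrN -!big_split /=; apply: eq_bigr => w _.
  have -> : B ^+ 2 - w ^+ 2 = (B + w) * (B - w) by ring.
  by rewrite chiM //; ring.
by rewrite sum_one sB sBm sG sF sE; ring.
Qed.

(** The explicit terms come from [w = 0], from [w ^+ 2 = g] and from [w = B] or [w = - B]; the last
    pair gives nothing new if [B = 0] or [B ^+ 2 = g]. Every other summand is 0 or 8, and the set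
    [T] where it is 8 is stable under the fixed-point-free map [w -> - w], so [#|T|] is even. *)
Lemma triple_sum_mod16 : exists m : int,
  triple_sum = (1 - chi (- g)) * (1 + chi B) ^+ 2 + sqrt_sum
    + (if (B == 0) || (B ^+ 2 - g == 0) then 0
       else 2 * (1 - chi (B ^+ 2 - g)) * (1 + chi (2 * B))) + 16 * m.
Proof.
rewrite /triple_sum (bigD1 0) //= expr0n /= sub0r subr0 addr0 -expr2.
rewrite (bigID (fun w => w ^+ 2 == g)) /=.
rewrite (eq_bigl (fun w => w ^+ 2 == g)) => [|w]; last first.
  by case: eqVneq => [->|//]; rewrite expr0n /= eq_sym (negPf g_neq0).
rewrite (eq_bigr (fun w => (1 + chi (B + w)) * (1 + chi (B - w)))) => [|w /eqP ->];
  last by rewrite subrr chi0 subr0 mul1r.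
rewrite -/sqrt_sum.
rewrite (bigID (fun w => w ^+ 2 == B ^+ 2)) /=.
rewrite (sum_const_on (v := (1 - chi (B ^+ 2 - g)) * (1 + chi (2 * B))));
  last first.
  move=> w /andP[_]; rewrite eqf_sqr => /orP[] /eqP ->.
    by rewrite subrr chi0 addr0 mulr1 mulr_natl.
  by rewrite sqrrN subrr chi0 addr0 mul1r opprK mulr_natl.
set T := [set w : F | [&& w != 0, chi (w ^+ 2 - g) == -1,
                      chi (B + w) == 1 & chi (B - w) == 1]].
have -> : \sum_(w | ((w != 0) && (w ^+ 2 != g)) && (w ^+ 2 != B ^+ 2))
    (1 - chi (w ^+ 2 - g)) * ((1 + chi (B + w)) * (1 + chi (B - w))) = 8 * #|T|%:Z.
  rewrite -sum1_card rmorph_sum /= mulr_sumr [RHS]big_mkcond [LHS]big_mkcond.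
  apply: eq_bigr => w _; rewrite inE -[w ^+ 2 == g]subr_eq0 -[w ^+ 2 == B ^+ 2]subr_eq0.
  have -> : (w ^+ 2 - B ^+ 2 == 0) = (B + w == 0) || (B - w == 0).
    rewrite -mulf_eq0 -oppr_eq0; congr (_ == 0); ring.
  case: (chiP (w ^+ 2 - g)); case: (chiP (B + w)); case: (chiP (B - w)) => *;
  by case: (w != 0).
have oT : ~~ odd #|T|.
  apply: (@even_card_involution F -%R T) => [|w|w].
  - exact: opprK.
  - by rewrite !inE oppr_eq0 sqrrN opprK => /and4P[-> -> -> ->].
  - by rewrite inE => /andP[w0 _]; apply: opp_neq.
have -> : #|[set w : F | ((w != 0) && (w ^+ 2 != g)) && (w ^+ 2 == B ^+ 2)]| =
   (if (B == 0) || (B ^+ 2 - g == 0) then 0%N else 2%N).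
  case: ifP => [Bg|/norP[B0 Bg]].
    apply/eqP; rewrite cards_eq0 -subset0; apply/subsetP => w; rewrite !inE.
    move: Bg; rewrite subr_eq0 => /orP[] /eqP -> /andP[/andP[w0 wg]].
      by rewrite expr0n sqrf_eq0 (negPf w0).
    by rewrite (negPf wg).
  apply/eqP; rewrite -eqz_nat -[2%N : int]/(1 + 1 : int) -{2}(chi_sqr B0).
  rewrite -card_sqrt //; apply/eqP; congr Posz; apply: eq_card => w; rewrite !inE.
  case: (w ^+ 2 =P B ^+ 2) => [wB|]; last by rewrite andbF.
  rewrite wB andbT -[B ^+ 2 == g]subr_eq0 Bg andbT.
  by apply: contraNneq B0 => w0; rewrite -sqrf_eq0 -wB w0 expr0n.
have [n Tn] : exists n : nat, #|T| = (n * 2)%N by exists #|T|./2; lia.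
by exists (n : int); rewrite Tn PoszM; case: ifP => _; ring.
Qed.

End Congruence.

(* With [d = - (2 c x + b)], [(b + w + d)^2 = 2 (b + w) (b + d)]. *)
Lemma chi_quadratic_root (F : finFieldType) (c b s x w : F) : 2 != 0 :> F ->
  c != 0 -> s != 0 -> b ^+ 2 - 4 * c * s != 0 ->
  c * x ^+ 2 + b * x + s = 0 -> w ^+ 2 = 4 * c * s ->
  chi x = chi (- c) * chi (b + w).
Proof.
move=> two_neq0 c0 s0 D0 xE wE; pose d := - (2 * c * x + b).
have dE : d ^+ 2 = b ^+ 2 - w ^+ 2.
  rewrite wE /d sqrrN.
  have -> : (2 * c * x + b) ^+ 2 =
    4 * c * (c * x ^+ 2 + b * x + s) + (b ^+ 2 - 4 * c * s) by ring.
  by rewrite xE mulr0 add0r.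
have w0 : w ^+ 2 != 0 by rewrite wE !mulf_neq0 ?four_neq0.
have sqE : (b + w) * (2 * (b + d)) = (b + w + d) ^+ 2.
  have -> : (b + w + d) ^+ 2 = (b + w) * (2 * (b + d)) + (w ^+ 2 + d ^+ 2 - b ^+ 2).
    by ring.
  by rewrite dE; ring.
have nz : b + w + d != 0.
  rewrite -sqrf_eq0 -sqE !mulf_neq0 //.
    apply: contraNneq D0 => bw; rewrite -wE.
    have -> : b ^+ 2 - w ^+ 2 = (b + w) * (b - w) by ring.
    by rewrite bw mul0r.
  apply: contraNneq w0 => bd.
  have -> : w ^+ 2 = b ^+ 2 - d ^+ 2 by rewrite dE; ring.
  have -> : b ^+ 2 - d ^+ 2 = (b + d) * (b - d) by ring.
  by rewrite bd mul0r.
have := chi_sqr nz; rewrite -sqE chiM //.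
rewrite -(@chi_sqrM F x (2 * c)) ?mulf_neq0 //.
(* Since [b + d = - 2 c x], this gives [chi x = chi (- c) * chi (2 * (b + d))], and the square above
   makes the last factor equal to [chi (b + w)]. *)
have -> : (2 * c) ^+ 2 * x = - c * (2 * (b + d)) by rewrite /d; ring.
rewrite (chiM two_neq0 (- c)).
by case: (chiP (b + w)); case: (chiP (2 * (b + d))) => // *; rewrite ?mulr1.
Qed.

(* The arguments [h1 h2 hc hs hB hD] stand for the values of [chi] at [-1], [2],
   [c], [s], [B] and [B ^ 2 - 4 c s]. *)
Definition root_const (eps h1 h2 hc hs hB hD : int) : int :=
  if hD == -1 then 0
  else if hD == 0 then 2 - 2 * eps * (h1 * h2 * hB * hc) + 2 * eps * (1 + h2 * hB)
  else if hc * hs == -1 then 4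
  else 4 + 4 * eps + 4 * (1 - h1 * hc).

(** Case analysis on [D = B ^+ 2 - g]. For a nonsquare [D] there are no roots, and
    [chi (B + w) * chi (B - w) = -1] kills each term of [sqrt_sum]. For [D = 0] there is one double
    root. For a nonzero square [D], either [g] is a nonsquare and [sqrt_sum] is empty, or
    [chi_quadratic_root] makes [chi] constant on the roots and on the values [B + w]. *)
Lemma root_sum_mod16 (F : finFieldType) (c B s : F) (eps : int) : 2 != 0 :> F ->
  c != 0 -> s != 0 -> eps = 1 \/ eps = -1 ->
  exists m : int,
  eps * sqrt_sum B (4 * c * s)
   + 2 * \sum_(x | (x != 0) && (c * x ^+ 2 + B * x + s == 0)) (1 - eps * chi x)
  = root_const eps (chi (-1 : F)) (chi (2 : F)) (chi c) (chi s) (chi B)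
      (chi (B ^+ 2 - 4 * c * s)) + 16 * m.
Proof.
move=> two_neq0 c0 s0 epsE; set g := 4 * c * s; set D := B ^+ 2 - g.
have f0 := four_neq0 two_neq0.
have g0 : g != 0 by rewrite !mulf_neq0.
pose Q x := c * x ^+ 2 + B * x + s.
have Q0 x : (x != 0) && (c * x ^+ 2 + B * x + s == 0) = (Q x == 0).
  rewrite /Q; case: eqVneq => [->|//].
  by rewrite expr0n /= !mulr0 !add0r (negPf s0).
rewrite (eq_bigl _ _ Q0).
have cardQ : #|[set x | Q x == 0]|%:Z = 1 + chi D by exact: card_quadratic_roots.
have cardg : #|[set w | w ^+ 2 == g]|%:Z = 1 + chi g by exact: card_sqrt.
have chi_g : chi g = chi c * chi s.
  rewrite /g -mulrA -(chiM two_neq0 c) -(@chi_sqrM F (c * s) 2) //; congr chi; ring.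
have sqrt_mul (w : F) : w ^+ 2 == g -> chi (B + w) * chi (B - w) = chi D.
  by move=> /eqP wg; rewrite -chiM // /D -/g -wg; congr chi; ring.
rewrite /root_const; case: (eqVneq (chi D) (-1)) => [DN|DN].
  exists 0; rewrite [X in 2 * X]big1 => [|x Qx]; last first.
    move: cardQ; rewrite DN subrr => /eqP; rewrite eqz_nat cards_eq0 => /eqP/setP.
    by move/(_ x); rewrite !inE Qx.
  rewrite /sqrt_sum big1 ?mulr0 ?addr0 // => w wg.
  have := sqrt_mul _ wg; rewrite DN.
  by case: (chiP (B + w)); case: (chiP (B - w)).
case: (eqVneq (chi D) 0) => [DZ|DZ].
  have D0 : D = 0 by apply/eqP; rewrite -chi_eq0 DZ.
  have Bg : B ^+ 2 = g by apply/eqP; rewrite -subr_eq0 -/D D0.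
  have B0 : B != 0 by rewrite -sqrf_eq0 Bg.
  exists 0.
  rewrite (sum_const_on
    (v := 1 - eps * (chi (-1 : F) * chi (2 : F) * chi B * chi c))); last first.
    move=> x Qx; congr (1 - eps * _); rewrite -!chiM // -(@chi_sqrM F x (2 * c)) ?mulf_neq0 //.
    have : (2 * c * x + B) ^+ 2 = 0.
      have -> : (2 * c * x + B) ^+ 2 = 4 * c * Q x + D by rewrite /Q /D /g; ring.
      by rewrite (eqP Qx) D0 mulr0 addr0.
    move/eqP; rewrite sqrf_eq0 addr_eq0 => /eqP xB; congr chi.
    have -> : (2 * c) ^+ 2 * x = 2 * c * (2 * c * x) by ring.
    by rewrite xB; ring.
  rewrite /sqrt_sum (sum_const_on (v := 1 + chi (2 : F) * chi B)); last first.
    move=> w; rewrite -Bg eqf_sqr -chiM // => /orP[] /eqP ->.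
      by rewrite subrr chi0 addr0 mulr1 mulr_natl.
    by rewrite opprK subrr chi0 addr0 mul1r mulr_natl.
  by rewrite cardQ cardg DZ -Bg chi_sqr //; ring.
have D1 : chi D = 1 by case: (chiP D) DN DZ.
have D0 : D != 0 by rewrite -chi_eq0 D1.
rewrite -chi_g; case: (eqVneq (chi g) (-1)) => [gN|gN].
  exists 0; rewrite /sqrt_sum big1 => [|w wg]; last first.
    move: cardg; rewrite gN subrr => /eqP; rewrite eqz_nat cards_eq0 => /eqP/setP.
    by move/(_ w); rewrite !inE wg.
  (* The product of the two roots is [s / c], so [x -> s / (c x)] permutes the roots; it flips [chi]
     because [chi (s / c) = chi g = -1]. *)
  have inv : \sum_(x | Q x == 0) (1 - eps * chi x) = \sum_(x | Q x == 0) (1 + eps * chi x).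
    have ij : injective (fun x : F => s / c * x^-1).
      by apply: inj_comp invr_inj; apply: mulfI; rewrite mulf_neq0 ?invr_eq0.
    rewrite (reindex_inj ij) /=; apply: eq_big => [x|x Qx].
      have [->|x0] := eqVneq x 0.
        by rewrite invr0 mulr0.
      have -> : Q (s / c * x^-1) = s / (c * x ^+ 2) * Q x.
        by rewrite /Q; field; rewrite ?c0 ?x0.
      by rewrite !mulf_eq0 invr_eq0 mulf_eq0 sqrf_eq0 (negPf s0) (negPf c0) (negPf x0).
    rewrite !chiM // !chiV // [_ * chi c]mulrC -chi_g gN; ring.
  have : 2 * \sum_(x | Q x == 0) (1 - eps * chi x) = 4.
    have -> : 2 * \sum_(x | Q x == 0) (1 - eps * chi x) =
      \sum_(x | Q x == 0) (1 - eps * chi x) + \sum_(x | Q x == 0) (1 + eps * chi x).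
      by rewrite -inv; ring.
    rewrite -big_split /= (sum_const_on (v := 2)) => [|x _]; last by ring.
    by rewrite cardQ D1.
  by move=> ->; ring.
have g1 : chi g = 1 by move: g0; rewrite -chi_eq0; case: (chiP g) gN.
have [x0 Qx0] : exists x, Q x == 0.
  have /card_gt0P[x] : (0 < #|[set x | Q x == 0%R]|)%N by rewrite -ltz_nat cardQ D1.
  by rewrite inE; exists x.
have [w0 gw0] : exists w, w ^+ 2 == g.
  have /card_gt0P[x] : (0 < #|[set x | x ^+ 2 == g]|)%N by rewrite -ltz_nat cardg g1.
  by rewrite inE; exists x.
have key x w : Q x == 0 -> w ^+ 2 == g -> chi x = chi (- c) * chi (B + w).
  by move=> /eqP Qx /eqP wg; apply: chi_quadratic_root Qx wg.
have nc2 : chi (- c) * chi (- c) = 1 by rewrite chi_squared // oppr_eq0.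
have key' w : w ^+ 2 == g -> chi (B + w) = chi (- c) * chi x0.
  by move=> wg; rewrite (key _ _ Qx0 wg) mulrA nc2 mul1r.
set e := chi (- c) * chi x0 in key'.
have e1 : e = 1 \/ e = -1.
  have : e != 0.
    rewrite -(key' _ gw0); apply/eqP => e0.
    by move: (sqrt_mul _ gw0); rewrite e0 mul0r D1.
  by rewrite -(key' _ gw0); case: (chiP (B + w0)); auto.
rewrite (sum_const_on (v := 1 - eps * (chi (- c) * e))); last first.
  by move=> x Qx; rewrite (key x w0) // key'.
rewrite /sqrt_sum (sum_const_on (v := (1 + e) * (1 + e))); last first.
  by move=> w wg; rewrite !key' // sqrrN.
rewrite cardQ cardg D1 g1 -chiM // mulN1r.
have : chi (- c) = 1 \/ chi (- c) = -1.
  by move: c0; rewrite -oppr_eq0 -chi_eq0; case: (chiP (- c)); auto.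
(* The unknown sign [e] is harmless: the two sides differ by [4 (1 - chi (- c)) (eps e - 1)], which
   is 0 or -16. *)
case: epsE => ->; case: e1 => ->; case=> ->; by [exists 0 | exists 1 | exists (-1)].
Qed.

(** What remains after the elimination in [sign_prod_congruence], with [q] the cardinality of the
    field. It depends on the field only through [q] and values of [chi], and this is what makes it
    periodic modulo 16. *)
Definition congruence_const (q eps h1 h2 hc hs hB hD : int) : int :=
  2 * (q - 1 - hc * (if hD == 0 then q - 1 else -1) + hs)
  + eps * (q + 1 + h1 * ((if hB == 0 then q - 1 else -1)
                         - (if hD == 0 then q - 1 else -1)))
  - eps * ((1 - h1 * (hc * hs)) * (1 + hB) ^+ 2
           + (if (hB == 0) || (hD == 0) then 0 else 2 * (1 - hD) * (1 + h2 * hB)))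
  - root_const eps h1 h2 hc hs hB hD.

(** By [sum_chi_cubic], the double of the formula for [4 N] contains [2 eps E], with [E] the sum
    occurring as [-2 E] in [triple_sum]. Adding [eps * triple_sum] eliminates [E] and leaves [S];
    the contributions of the roots of the quadratic and of [sqrt_sum] are combined by
    [root_sum_mod16]. *)
Lemma sign_prod_congruence (F : finFieldType) (c B s k : F) (eps S : int) :
  2 != 0 :> F -> c != 0 -> s != 0 -> eps = 1 \/ eps = -1 ->
  4 * c * s * k = - (B ^+ 2 - 4 * c * s) ->
  S = \sum_y chi (y * (y + 1) * (y + k)) ->
  exists N : nat,
    sign_prod eps (fun x => c * x ^+ 2 + B * x + s) = (-1) ^+ N /\
    exists m : int,
    8 * N%:Z + eps * chi (-1 : F) * (chi c * chi s) * S =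
    congruence_const #|F| eps (chi (-1 : F)) (chi (2 : F)) (chi c) (chi s)
      (chi B) (chi (B ^+ 2 - 4 * c * s)) + 16 * m.
Proof.
move=> two_neq0 c0 s0 epsE kE SE.
have [N [NE N4]] := sign_prodE two_neq0 (fun x => c * x ^+ 2 + B * x + s) epsE.
exists N; split => //.
have g0 : 4 * c * s != 0 by rewrite !mulf_neq0 ?four_neq0.
have [m1 Z1] := triple_sum_mod16 two_neq0 B g0.
have Z2 := triple_sumE two_neq0 B g0.
have [m2 R] := root_sum_mod16 B two_neq0 c0 s0 epsE.
have gk : 4 * c * s * (1 - k) = B ^+ 2 by rewrite mulrBr kE; ring.
have X := sum_chi_legendre_form two_neq0 g0 gk SE.
move: N4; rewrite sum_chi_quadratic // sum_chi_cubic //.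
rewrite expr0n /= !mulr0 !add0r => N4.
have chi_g : chi (4 * c * s) = chi c * chi s.
  rewrite -mulrA -(chiM two_neq0 c) -(@chi_sqrM F (c * s) 2) //; congr chi; ring.
have chi_ng : chi (- (4 * c * s)) = chi (-1 : F) * (chi c * chi s).
  by rewrite -chi_g -chiM // mulN1r.
have chi_2B : chi (2 * B) = chi (2 : F) * chi B by rewrite chiM.
move: Z1 Z2 X; rewrite /congruence_const !chi_eq0 chi_g chi_ng chi_2B.
rewrite [4 * c * s == _]eq_sym -[_ == 4 * c * s]subr_eq0 => Z1 Z2 X.
move: Z1; rewrite Z2 X => Z1.
exists (- m2 - eps * m1); move: N4 Z1 R.
set E := \sum_w _; set R0 := \sum_(x | _) _; move: (sqrt_sum _ _) E R0 => Zs E R0.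
move: (root_const _ _ _ _ _ _ _) => L.
move: (if B == 0 then _ else _) (if B ^+ 2 - 4 * c * s == 0 then _ else _)
  (if _ || _ then _ else _) => i1 i2 i3.
by move=> *; case: epsE => ?; subst eps; lra.
Qed.


(** Euler's criterion. There are [n] nonzero squares because [chi] sums to 0, and all are roots of
    ['X^n - 1]; a nonsquare [x] with [x ^+ n = 1] would be one root too many. *)
Lemma chi_euler (F : finFieldType) (n : nat) (x : F) :
  2 != 0 :> F -> #|F| = n.*2.+1 -> x ^+ n = (chi x)%:~R.
Proof.
move=> two_neq0 cF.
have n_gt0 : (0 < n)%N.
  have : (1 < #|F|)%N by rewrite (cardD1 0) (cardD1 1) !inE oner_neq0.
  by rewrite cF; lia.
have sqr_root (y : F) : y != 0 -> (y ^+ 2) ^+ n = 1.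
  move=> y0; apply: (mulfI y0); rewrite mulr1 -exprM mul2n -exprS -cF.
  exact: expf_card.
case: (chiP x) => [->|y -> y0|nx].
- by rewrite expr0n; case: n n_gt0 {cF sqr_root}.
- exact: sqr_root.
have x0 : x != 0 by have := nx 0; rewrite expr0n.
have : (x ^+ n) ^+ 2 == 1 by rewrite -exprM mulnC exprM sqr_root.
rewrite sqrf_eq1 => /orP[/eqP xn|/eqP ->]; last by rewrite rmorphN1.
pose rs := x :: enum [set y : F | chi y == 1].
have card1 : #|[set y : F | chi y == 1]| = n.
  have := sum_chi two_neq0; rewrite (bigD1 0) //= chi0 add0r.
  have : #|F|%:Z = 1 + \sum_(y : F | y != 0) 1.
    by rewrite -(sum_one F) (bigD1 0).
  move=> c1 c2; have : 2 * #|[set y : F | chi y == 1]|%:Z = #|F|%:Z - 1.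
    rewrite c1 addrAC subrr add0r -[RHS]addr0 -[X in _ + X]c2 -big_split /=.
    rewrite -sum1_card rmorph_sum /= mulr_sumr [RHS]big_mkcond [LHS]big_mkcond.
    by apply: eq_bigr => y _; rewrite inE; case: (chiP y).
  by rewrite {c1 c2}cF; move: (#|_|); lia.
have sz : size ('X^n - 1%:P : {poly F}) = n.+1 by rewrite size_XnsubC.
have := @max_poly_roots F ('X^n - 1%:P) rs.
rewrite -size_poly_eq0 sz /= -cardE card1 ltnn => roots.
suff : false by [].
apply: roots => //.
  rewrite rootE !hornerE xn subrr eqxx /=; apply/allP => y.
  rewrite mem_enum inE => /eqP; case: (chiP y) => // z -> z0 _.
  by rewrite rootE !hornerE sqr_root // subrr.
rewrite enum_uniq andbT mem_enum inE.
by case: (chiP x) nx => // z -> _ /(_ z); rewrite eqxx.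
Qed.

(** * Gauss's lemma over a prime field *)

Section PrimeField.

Variable p : nat.
Hypothesis p_prime : prime p.
Hypothesis p_odd : odd p.

Local Notation F := 'F_p.
Local Notation n := p./2.

Lemma Fp_two_neq0 : 2 != 0 :> F.
Proof.
rewrite -(dvdn_pcharf (pchar_Fp p_prime)); apply/negP => /dvdn_leq.
have := prime_gt1 p_prime; move: p_odd.
by case: p => [|[|[|[|m]]]] // _ _ /(_ isT).
Qed.

Lemma Fp_val_lt (x : F) : (x < p)%N.
Proof. by have := ltn_ord x; rewrite [X in (_ < X)%N -> _]Fp_cast. Qed.

Lemma Fp_val_nat (m : nat) : (m%:R : F) = (m %% p)%N :> nat.
Proof. exact: val_Fp_nat. Qed.

Lemma Fp_valK (x : F) : (x : nat)%:R = x.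
Proof. exact: natr_Zp. Qed.

Lemma Fp_val_eq0 (x : F) : (x == 0) = (x == 0%N :> nat).
Proof. by rewrite -val_eqE. Qed.

Lemma Fp_valN (x : F) : x != 0 -> - x = (p - x)%N :> nat.
Proof.
move=> x0; have xp := Fp_val_lt x; rewrite Fp_val_eq0 in x0.
have -> : - x = (p - x)%N%:R.
  by rewrite natrB ?(ltnW xp) // pchar_Fp_0 // Fp_valK sub0r.
by rewrite Fp_val_nat modn_small //; lia.
Qed.

Lemma Fp_valD (x y : F) : x + y = ((x + y) %% p)%N :> nat.
Proof. by rewrite -Fp_val_nat natrD !Fp_valK. Qed.

(** Representatives of the nonzero elements up to sign; they are also the values of [j] in the
    product P(p). *)
Definition half_system : {set F} := [set h : F | 0 < h <= n]%N.

Definition Fp_abs (x : F) : F := if (x <= n)%N then x else - x.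

Lemma Fp_abs_half x : x != 0 -> Fp_abs x \in half_system.
Proof.
move=> x0; rewrite inE /Fp_abs; have := Fp_val_lt x; have x0' := x0.
rewrite Fp_val_eq0 in x0; case: (leqP x n) => xn; first by lia.
by rewrite Fp_valN // => xp; have := odd_double_half p; lia.
Qed.

Lemma half_neq0 h : h \in half_system -> h != 0.
Proof. by rewrite inE Fp_val_eq0 => /andP[]; lia. Qed.

Lemma half_opp h k : h \in half_system -> k \in half_system -> h != - k.
Proof.
move=> hH kH; have k0 := half_neq0 kH; apply/eqP => hk; move: hH.
rewrite hk inE Fp_valN // => /andP[_]; move: kH; rewrite inE => /andP[_].
by have := odd_double_half p; have := Fp_val_lt k; lia.
Qed.

Lemma Fp_abs_sign x : Fp_abs x = (-1) ^+ (n < x)%N * x.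
Proof. by rewrite /Fp_abs; case: leqP; rewrite ?mul1r ?mulN1r. Qed.

Lemma half_abs_inj t : t != 0 ->
  {in half_system &, injective (fun h => Fp_abs (t * h))}.
Proof.
move=> t0 h k hH kH /=; rewrite /Fp_abs.
case: (leqP (t * h)%R n) => _; case: (leqP (t * k)%R n) => _.
- exact: mulfI.
- by rewrite -mulrN => /(mulfI t0) hk; case/eqP: (half_opp hH kH).
- by rewrite -mulrN => /(mulfI t0) hk; case/eqP: (half_opp kH hH).
- by move/oppr_inj/(mulfI t0).
Qed.

Lemma half_abs_image t : t != 0 ->
  [set Fp_abs (t * h) | h in half_system] = half_system.
Proof.
move=> t0; apply/eqP; rewrite eqEcard card_in_imset ?leqnn ?andbT; last exact: half_abs_inj.
apply/subsetP => x /imsetP[h hH ->]; apply: Fp_abs_half.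
by rewrite mulf_neq0 // half_neq0.
Qed.

Lemma big_half_abs (R : Type) (idx : R) (op : Monoid.com_law idx) t (G : F -> R) :
  t != 0 ->
  \big[op/idx]_(h in half_system) G (Fp_abs (t * h)) =
  \big[op/idx]_(h in half_system) G h.
Proof.
by move=> t0; rewrite -{2}(half_abs_image t0) big_imset //; apply: half_abs_inj.
Qed.

Lemma big_Fp_nat (R : Type) (idx : R) (op : Monoid.law idx) (P : pred nat) (G : nat -> R) :
  \big[op/idx]_(0 <= i < p | P i) G i = \big[op/idx]_(x : F | P x) G x.
Proof. by rewrite -{1}(Fp_cast p_prime) big_mkord. Qed.

Lemma big_half_nat (R : Type) (idx : R) (op : Monoid.com_law idx) (G : nat -> R) :
  \big[op/idx]_(h in half_system) G h = \big[op/idx]_(1 <= j < n.+1) G j.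
Proof.
rewrite (eq_bigl (fun h : F => 0 < h <= n)%N) => [|h]; last by rewrite inE.
rewrite -(big_Fp_nat _ (fun h => 0 < h <= n)%N G).
rewrite [RHS](@big_nat_widen _ _ _ 1 n.+1 p); last by have := odd_double_half p; lia.
rewrite [RHS](@big_nat_widenl _ _ _ 1 0) //.
by apply: eq_bigl => j; rewrite ltnS andbC.
Qed.

Lemma card_half_system : #|half_system| = n.
Proof.
rewrite -sum1_card (big_half_nat _ (fun=> 1%N)) sum_nat_const_nat; lia.
Qed.

Definition gauss_count (t : F) : nat := \sum_(h in half_system) (n < (t * h)%R)%N.

Lemma gauss_lemma t : t != 0 -> chi t = (-1) ^+ gauss_count t.
Proof.
move=> t0; have cF : #|F| = n.*2.+1.
  by rewrite card_Fp // -{1}(odd_double_half p) p_odd.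
have := chi_euler t Fp_two_neq0 cF.
have P0 : \prod_(h in half_system) h != 0 by apply/prodf_neq0 => h; apply: half_neq0.
have -> : t ^+ n = (-1) ^+ gauss_count t.
  apply: (mulIf P0); rewrite -{1}card_half_system -prodr_const -big_split /=.
  rewrite -(@big_half_abs _ _ _ t id t0) /gauss_count expr_sum -big_split /=.
  by apply: eq_bigr => h _; rewrite Fp_abs_sign mulrA -expr2 sqrr_sign mul1r.
rewrite -(signr_odd F) -(signr_odd int).
have m1 : (-1 : F) != 1 by rewrite opp_neq ?Fp_two_neq0 ?oner_neq0.
have m1' : (1 : F) != -1 by rewrite eq_sym.
move: t0; case: (odd _); rewrite /= ?expr0 ?expr1; case: (chiP t) => //.
  by move=> y _ _ _ /eqP; rewrite (negPf m1).
by rewrite rmorphN1 => _ _ /eqP; rewrite (negPf m1').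
Qed.

Lemma Fp_odd_abs (x : F) : odd (Fp_abs x) = odd x (+) (n < x)%N.
Proof.
rewrite /Fp_abs; case: (leqP x n) => xn; first by rewrite addbF.
have x0 : x != 0 by rewrite Fp_val_eq0; lia.
by rewrite Fp_valN // oddB ?p_odd ?addbT // ltnW // Fp_val_lt.
Qed.

(** The number of pairs [(i, j)] of slope [i / j = t] in the range of P(p), that is, the exponent of
    [chi (f(t, 1))]. *)
Definition below_count (t : F) : nat :=
  \sum_(h in half_system) (0 < (t * h)%R < h)%N.

(* With [a], [b] and [j] the residues of [t h], [(1 - t) h] and [h], either
   [a + b = j], and then [a < j], or [a + b = j + p], and then [a > j]. *)
Lemma below_count_term t h : t != 0 -> t != 1 -> h \in half_system ->
  ~~ odd ((0 < (t * h)%R < h)%N + 1 + h + Fp_abs (t * h) + Fp_abs ((1 - t) * h)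
    + (n < (t * h)%R)%N + (n < ((1 - t) * h)%R)%N).
Proof.
move=> t0 t1 hH; rewrite !oddD !Fp_odd_abs !oddb.
have hD : h = (((t * h)%R + ((1 - t) * h)%R) %% p)%N :> nat.
  by rewrite -Fp_valD -mulrDl addrC subrK mul1r.
have h0 := half_neq0 hH.
have : t * h != 0 by rewrite mulf_neq0.
have : (1 - t) * h != 0 by rewrite mulf_neq0 // subr_eq0 eq_sym.
move: (Fp_val_lt (t * h)) (Fp_val_lt ((1 - t) * h)) (Fp_val_lt h) hD h0.
rewrite !Fp_val_eq0; move: (nat_of_ord (t * h)) (nat_of_ord ((1 - t) * h)) (nat_of_ord h) => a b j.
move=> ap bp jp jE j0 b0 a0.
have : ~~ odd ((0 < a < j)%N + 1 + j + a + b).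
  have [abp|abp] := ltnP (a + b) p; move: jE.
    by rewrite modn_small // => ->; have -> : (0 < a < a + b)%N by [lia]; lia.
  rewrite -[(a + b)%N](subnK abp) modnDr modn_small; last by lia.
  move=> jE; have -> : (0 < a < j)%N = false by lia.
  have -> : (0 + 1 + j + a + b = j.*2 + p.+1)%N by lia.
  by rewrite oddD odd_double /= p_odd.
rewrite !oddD !oddb.
by case: (_ < _ < _)%N; case: (odd j); case: (odd a); case: (odd b);
  case: (n < a)%N; case: (n < b)%N.
Qed.

(* The sign not depending on [t] is found by taking [t = -1], where the count
   is zero. *)
Lemma below_count_sign (t : F) : t != 0 -> t != 1 ->
  (-1) ^+ below_count t = chi (-2 : F) * chi t * chi (1 - t).
Proof.
have parity (u : F) : u != 0 -> u != 1 ->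
  odd (below_count u) = odd (n + \sum_(h in half_system) (h : nat))
    (+) odd (gauss_count u) (+) odd (gauss_count (1 - u)).
  move=> u0 u1; have u1' : 1 - u != 0 by rewrite subr_eq0 eq_sym.
  have abs_sum (v : F) : v != 0 ->
      (\sum_(h in half_system) Fp_abs (v * h)%R = \sum_(h in half_system) (h : nat))%N.
    by move=> v0; rewrite (big_half_abs _ (fun h : F => h : nat) v0).
  (* Summed over [h], the representatives of [u h] and of [(1 - u) h] up to sign both run through
     the half system, so each contributes the same total as [h] itself. Modulo 2 only one copy of
     this total survives. *)
  have : ~~ odd (\sum_(h in half_system) ((0 < (u * h)%R < h)%N + 1 + h
      + Fp_abs (u * h)%R + Fp_abs ((1 - u) * h)%R
      + (n < (u * h)%R)%N + (n < ((1 - u) * h)%R)%N)).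
    apply: (big_ind (fun m => ~~ odd m)) => // [x y|h hH].
      by rewrite oddD => /negPf -> /negPf ->.
    exact: below_count_term.
  rewrite !big_split /= sum1_card card_half_system !abs_sum //.
  rewrite -/(below_count u) -/(gauss_count u) -/(gauss_count (1 - u)) !oddD.
  by do 5!case: (odd _).
move=> t0 t1; have m1 : (-1 : F) != 1 by rewrite opp_neq ?Fp_two_neq0 ?oner_neq0.
(* The residue of [- h] is [p - h], which exceeds [h]. As [1 - t = 2] for [t = -1], the constant
   sign is [chi (-1) * chi 2 = chi (-2)]. *)
have below0 : below_count (-1) = 0%N.
  rewrite /below_count big1 // => h hH; rewrite mulN1r Fp_valN ?half_neq0 //.
  by move: hH; rewrite inE; lia.
have := parity (-1) (eq_ind_r negb (negbT (oner_eq0 F)) (oppr_eq0 1)) m1.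
rewrite below0 opprK => c1.
have -> : -2 = -1 * (1 + 1) :> F by ring.
have two : (1 + 1 : F) != 0 by exact: Fp_two_neq0.
have t1' : 1 - t != 0 by rewrite subr_eq0 eq_sym.
rewrite (chiM Fp_two_neq0) !gauss_lemma ?oppr_eq0 ?oner_eq0 //.
rewrite -!exprD -signr_odd -[RHS]signr_odd parity // !oddD; congr ((-1) ^+ nat_of_bool _).
by move: c1; rewrite !oddD /=; do 6!case: (odd _).
Qed.

Lemma Fp_dvd (z : int) : (p %| z)%Z = (z%:~R == 0 :> F).
Proof. exact: (dvdz_pcharf (pchar_Fp p_prime)). Qed.

Lemma legendre_chi (z : int) : legendre z p = chi (z%:~R : F).
Proof.
have mod_sqr (m : nat) : (z == m%:Z ^+ 2 %[mod p])%Z = (z%:~R == (m%:R : F) ^+ 2).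
  by rewrite eqz_mod_dvd Fp_dvd rmorphB rmorphXn /= subr_eq0.
rewrite /legendre /chi Fp_dvd; case: eqP => // _; congr (if _ then _ else _).
apply/existsP/existsP => [[y]|[y]].
  by rewrite mod_sqr; exists (y : nat)%:R.
by exists (Ordinal (Fp_val_lt y)); rewrite mod_sqr /= Fp_valK.
Qed.

(** * The product P(p) in terms of slopes *)

Definition qformF (a b c x y : F) : F := a * x ^+ 2 + b * x * y + c * y ^+ 2.

Lemma PprodE (a b c : int) : Pprod a b c p =
  \prod_(h in half_system)
    \prod_(x : F | (0 < x < h)%N && (qformF a%:~R b%:~R c%:~R x h != 0))
      chi (qformF a%:~R b%:~R c%:~R x h).
Proof.
have qE (x y : F) : (qform a b c (x : nat) (y : nat))%:~R =
    qformF a%:~R b%:~R c%:~R x y :> F.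
  by rewrite /qform /qformF !expr2 !rmorphD !rmorphM /= -!pmulrn !Fp_valK.
rewrite /Pprod [LHS](@big_nat_widenl _ _ _ 1 0) //.
rewrite (big_Fp_nat _ (fun j => (2 * j < p)%N && (1 <= j)%N)
  (fun j => \prod_(1 <= i < j | ~~ (p %| qform a b c i j)%Z) legendre (qform a b c i j) p)).
apply: eq_big => [h|h _].
  by rewrite inE andbC; have := odd_double_half p; lia.
rewrite (@big_nat_widen _ _ _ 1 h p); last exact/ltnW/Fp_val_lt.
rewrite (@big_nat_widenl _ _ _ 1 0) //.
rewrite (big_Fp_nat _ (fun i => (~~ (p %| qform a b c i h)%Z && (i < h)%N) && (1 <= i)%N)
  (fun i => legendre (qform a b c i h) p)).
apply: eq_big => [x|x _]; last by rewrite legendre_chi qE.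
rewrite -qE -Fp_dvd.
by case: (p %| _)%Z; case: (x < h)%N; case: (0 < x)%N.
Qed.

(** With [i = t j], the value [f(i, j)] is [f(t, 1)] times the square [j^2]. After exchanging the
    products, the factor at [t] has exponent [below_count t], whose parity is given by
    [below_count_sign]. *)
Lemma Pprod_slope (a b c : int) : Pprod a b c p =
  \prod_(t : F | (chi (t * (1 - t)) == - chi (-2 : F))
                 && (qformF a%:~R b%:~R c%:~R t 1 != 0))
    chi (qformF a%:~R b%:~R c%:~R t 1).
Proof.
rewrite PprodE; set q := qformF _ _ _.
have chi_q t h : h != 0 -> chi (q (t * h) h) = chi (q t 1).
  move=> h0; rewrite -[RHS](chi_sqrM (q t 1) h0); congr chi.
  by rewrite /q /qformF; ring.
transitivity (\prod_(h in half_system)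
    \prod_(t | (0 < (t * h)%R < h)%N && (q t 1 != 0)) chi (q t 1)).
  apply: eq_bigr => h hH; have h0 := half_neq0 hH.
  rewrite (reindex_inj (mulIf h0)) /=.
  by apply: eq_big => [t|t _]; rewrite -?chi_eq0 chi_q.
rewrite (exchange_big_dep (fun t => q t 1 != 0)) /=; last by move=> h t _ /andP[].
rewrite [LHS]big_mkcond [RHS]big_mkcond; apply: eq_bigr => t _.
have [qt|qt] := boolP (q t 1 == 0); rewrite ?andbF ?andbT //=.
rewrite (eq_bigl (fun h => (h \in half_system) && (0 < (t * h)%R < h)%N)) => [|h];
  last by rewrite andbT.
rewrite prodr_const.
have -> : #|[pred h | (h \in half_system) && (0 < (t * h)%R < h)%N]| = below_count t.
  rewrite -sum1_card /below_count [RHS]big_mkcond [LHS]big_mkcond.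
  by apply: eq_bigr => h _; rewrite inE; case: (h \in _); case: (_ < _ < _)%N.
have -> : chi (q t 1) ^+ below_count t = if odd (below_count t) then chi (q t 1) else 1.
  rewrite -{1}(odd_double_half (below_count t)) exprD -mul2n exprM expr2.
  by rewrite chi_squared // expr1n mulr1; case: (odd _).
congr (if _ then _ else _).
have two0 : chi (-2 : F) != 0 by rewrite chi_eq0 oppr_eq0 Fp_two_neq0.
(* At the slopes 0 and 1, not covered by [below_count_sign], the count is 0 and
   [chi (t * (1 - t)) = 0] differs from [- chi (-2)]. *)
have [->|t0] := eqVneq t 0.
  have -> : below_count 0 = 0%N by rewrite /below_count big1 // => h _; rewrite mul0r.
  by rewrite mul0r chi0 eq_sym oppr_eq0 (negPf two0).
have [->|t1] := eqVneq t 1.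
  have -> : below_count 1 = 0%N.
    by rewrite /below_count big1 // => h _; rewrite mul1r ltnn andbF.
  by rewrite subrr mulr0 chi0 eq_sym oppr_eq0 (negPf two0).
have := below_count_sign t0 t1; rewrite -mulrA -(chiM Fp_two_neq0 t) -signr_odd.
have : t * (1 - t) != 0 by rewrite mulf_neq0 // subr_eq0 eq_sym.
move: two0; rewrite -!chi_eq0; move: (chi_cases (x := -2 : F)) (chi_cases (x := t * (1 - t))).
rewrite -!chi_eq0 => c1 c2 /c1 {c1} /orP[] /eqP -> /c2 {c2} /orP[] /eqP ->;
  by case: (odd _).
Qed.

End PrimeField.


(* [t = (1 + x)^-1]; at [x = -1] the junk value [0^-1 = 0] keeps this a bijection. *)
Lemma Pprod_sign_prod (p : nat) (a b c : int) : prime p -> odd p ->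
  let eps := chi (-2 : 'F_p) in
  Pprod a b c p *
    (if (chi (-1 : 'F_p) == - eps) && ((a%:~R : 'F_p) != 0) then chi (a%:~R : 'F_p) else 1)
  = sign_prod eps (fun x : 'F_p =>
      c%:~R * x ^+ 2 + (b + 2 * c)%:~R * x + (a + b + c)%:~R).
Proof.
move=> p_prime p_odd eps; rewrite Pprod_slope // -/eps.
have two0 := Fp_two_neq0 p_prime p_odd.
have inj : injective (fun x : 'F_p => (1 + x)^-1) by apply: inj_comp invr_inj (@addrI _ 1).
rewrite (reindex_inj inj) /= /sign_prod [X in X * _]big_mkcond [RHS]big_mkcond /=.
rewrite [X in X * _](bigD1 (-1)) //= [RHS](bigD1 (-1)) //=.
have eps0 : - eps != 0 by rewrite oppr_eq0 chi_eq0 oppr_eq0.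
(* At [x = -1] the slope is the junk value 0, absent from P(p), whereas the quadratic takes the
   value [a] there: this is the correcting factor. *)
rewrite subrr invr0 mul0r chi0 eq_sym (negPf eps0) mul1r mulrC; congr (_ * _).
  have -> : c%:~R * (-1) ^+ 2 + (b + 2 * c)%:~R * -1 + (a + b + c)%:~R = a%:~R :> 'F_p.
    by rewrite !rmorphD !rmorphM /=; ring.
  by [].
apply: eq_bigr => x x1.
have x10 : 1 + x != 0 by rewrite addrC addr_eq0.
have -> : chi ((1 + x)^-1 * (1 - (1 + x)^-1)) = chi x.
  by rewrite -(chi_sqrM _ x10); congr chi; field.
set Q := _ + (a + b + c)%:~R.
have -> : qformF a%:~R b%:~R c%:~R (1 + x)^-1 1 = (1 + x)^-1 ^+ 2 * Q.
  by rewrite /Q /qformF !rmorphD !rmorphM /=; field.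
by rewrite chi_sqrM ?invr_eq0 // mulf_eq0 sqrf_eq0 invr_eq0 (negPf x10).
Qed.

(** * Periodicity of the Legendre symbol *)

Lemma sum_ltn_iota (q n : nat) : (\sum_(1 <= j < n.+1) (q < j) = n - q)%N.
Proof.
elim: n => [|n IHn]; first by rewrite big_geq.
by rewrite big_nat_recr //= IHn; lia.
Qed.

Lemma sum_leq_iota (m n : nat) : (m < n)%N -> (\sum_(1 <= k < n) (k <= m) = m)%N.
Proof.
have H : (\sum_(1 <= k < n.+1) (k <= m) = minn m n)%N.
  elim: n => [|n IHn]; first by rewrite big_geq // minn0.
  by rewrite big_nat_recr //= IHn; lia.
case: n H => [//|n] H mn.
have := H; rewrite big_nat_recr //=; lia.
Qed.

(* Parity of [\sum_j (2 a j) %/ p], summed over the lattice points by columns. *)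
Lemma gauss_count_lattice (p a : nat) : prime p -> odd p -> (0 < a)%N ->
  odd (gauss_count (a%:R : 'F_p)) =
  odd (\sum_(1 <= k < a) (p./2 - (k * p - 1) %/ (2 * a))).
Proof.
move=> p_prime p_odd a0; have p0 := prime_gt0 p_prime.
have pE := odd_double_half p; rewrite p_odd in pE.
have -> : gauss_count (a%:R : 'F_p) = (\sum_(1 <= j < p./2.+1) (p./2 < (a * j) %% p))%N.
  rewrite -(big_half_nat p_prime p_odd _ (fun j => (p./2 < (a * j) %% p)%N : nat)).
  apply: eq_bigr => h _; congr (nat_of_bool (_ < _)%N).
  by rewrite -(Fp_val_nat p_prime) natrM Fp_valK.
(* With [r] the residue of [a j], the quotient [(2 a j) %/ p] is an even number plus [(2 r) %/ p],
   which is 1 exactly when [r > p./2]. *)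
have -> : odd (\sum_(1 <= j < p./2.+1) (p./2 < (a * j) %% p)) =
          odd (\sum_(1 <= j < p./2.+1) (2 * a * j) %/ p).
  apply: (big_ind2 (fun x y => odd x = odd y)) => // [x1 x2 y1 y2 e1 e2|j _].
    by rewrite !oddD e1 e2.
  rewrite -mulnA {2}(divn_eq (a * j) p) mulnDr mulnA divnMDl // oddD oddM /=.
  have := ltn_pmod (a * j) p0; move: (_ %% p)%N => r rp.
  case: ltnP => pr.
    have -> : (2 * r = 1 * p + (2 * r - p))%N by lia.
    by rewrite divnMDl // divn_small //; lia.
  by rewrite divn_small //; lia.
congr odd.
(* The quotient counts the [k] in [1 .. a - 1] with [k p <= 2 a j]. Subtracting 1 makes the
   inequality strict, so that it reads [(k p - 1) %/ (2 a) < j]. *)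
transitivity (\sum_(1 <= j < p./2.+1) \sum_(1 <= k < a) (((k * p - 1) %/ (2 * a) < j) : nat))%N.
  apply: eq_big_nat => j /andP[j1 jn].
  rewrite -[LHS](@sum_leq_iota _ a); last by rewrite ltn_divLR //; nia.
  apply: eq_big_nat => k /andP[k1 _]; congr nat_of_bool.
  by rewrite leq_divRL // ltn_divLR; nia.
rewrite exchange_big_nat /=; apply: eq_big_nat => k _; exact: sum_ltn_iota.
Qed.

(** Replacing [p] by [p + 4 a q] adds [2 a q] to [p./2] and [2 k q] to the quotient in the term at
    [k], so no term of the lattice count changes parity. *)
Lemma chi_nat_periodic (p1 p2 a : nat) :
  prime p1 -> odd p1 -> prime p2 -> odd p2 -> (0 < a)%N ->
  (a%:R : 'F_p1) != 0 -> (a%:R : 'F_p2) != 0 -> p1 = p2 %[mod 4 * a] ->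
  chi (a%:R : 'F_p1) = chi (a%:R : 'F_p2).
Proof.
wlog p12 : p1 p2 / (p1 <= p2)%N => [H|].
  case: (leqP p1 p2) => [|/ltnW] p12; first exact: H.
  by move=> *; apply/esym/H.
move=> pr1 o1 pr2 o2 a0 a1 a2 /esym/eqP.
rewrite eqn_mod_dvd // => /dvdnP[q p2E].
rewrite !gauss_lemma // -signr_odd -[RHS]signr_odd; congr ((-1) ^+ nat_of_bool _).
rewrite !gauss_count_lattice //.
have E1 := odd_double_half p1; rewrite o1 in E1.
have E2 := odd_double_half p2; rewrite o2 in E2.
rewrite [in LHS]big_nat_cond [in RHS]big_nat_cond.
apply: (big_ind2 (fun x y => odd x = odd y)) => // [x1 x2 y1 y2 e1 e2|k].
  by rewrite !oddD e1 e2.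
rewrite andbT => /andP[k1 ka].
have le (p : nat) : p = p./2.*2.+1 -> ((k * p - 1) %/ (2 * a) <= p./2)%N.
  by move=> pE; rewrite -ltnS ltn_divLR; nia.
have -> : (k * p2 - 1 = (2 * k * q) * (2 * a) + (k * p1 - 1))%N by nia.
rewrite divnMDl; last by lia.
have := le _ (esym E1); have := le _ (esym E2).
have -> : (k * p2 - 1 = (2 * k * q) * (2 * a) + (k * p1 - 1))%N by nia.
rewrite divnMDl; last by lia.
move=> l2 l1; rewrite !oddB // oddD -mulnA oddM /=; congr (_ (+) _).
have -> : (p2./2 = p1./2 + (a * q).*2)%N by lia.
by rewrite oddD odd_double addbF.
Qed.


Lemma primes_gt3_odd p : primes_gt3 p -> prime p /\ odd p.
Proof.
by move=> /andP[pr p3]; split => //; case: (even_prime pr) p3 => // ->.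
Qed.

Lemma chi_opp1 p : prime p -> odd p -> chi (-1 : 'F_p) = (-1) ^+ p./2.
Proof.
move=> pr po; rewrite (gauss_lemma pr po) ?oppr_eq0 ?oner_eq0 //; congr (_ ^+ _).
rewrite /gauss_count -[RHS](card_half_system pr po) -sum1_card; apply: eq_bigr => h hH.
have h0 := half_neq0 pr po hH; rewrite mulN1r (Fp_valN pr) //.
by move: hH; rewrite inE; have := odd_double_half p; lia.
Qed.

Lemma eqn_mod_dvdr d m p1 p2 : (d %| m)%N -> p1 = p2 %[mod m] -> p1 = p2 %[mod d].
Proof. by move=> dm pp; rewrite -(modn_dvdm p1 dm) pp modn_dvdm. Qed.

Lemma prime_eq_mod (p1 p2 m : nat) : prime p1 -> prime p2 -> (p1 %| m)%N ->
  p1 = p2 %[mod m] -> p1 = p2.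
Proof.
move=> pr1 pr2 p1m /(eqn_mod_dvdr p1m); rewrite modnn => /esym/eqP.
by rewrite -/(dvdn _ _) dvdn_prime2 // => /eqP.
Qed.

Lemma odd_half_mod4 p1 p2 : odd p1 -> odd p2 -> p1 = p2 %[mod 4] ->
  odd p1./2 = odd p2./2.
Proof. lia. Qed.

(** A prime dividing [z] divides the modulus [4 |z|], so it is the only prime in its class. For the
    others the absolute value is handled by [chi_nat_periodic] and the sign by the class modulo
    4. *)
Lemma legendre_periodic (z : int) : periodic primes_gt3 (legendre z).
Proof.
have [->|z0] := eqVneq z 0.
  by exists 1%N => // p1 p2 _ _ _; rewrite /legendre !dvdz0.
exists (4 * `|z|)%N => [|p1 p2 /primes_gt3_odd[pr1 o1] /primes_gt3_odd[pr2 o2] pp].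
  by rewrite muln_gt0 absz_gt0.
have [d1|n1] := boolP (p1 %| z)%Z.
  by rewrite (prime_eq_mod pr1 pr2 _ pp) // dvdn_mull.
have [d2|n2] := boolP (p2 %| z)%Z.
  by rewrite (prime_eq_mod pr2 pr1 _ (esym pp)) // dvdn_mull.
have n1' := n1; have n2' := n2; rewrite (Fp_dvd pr1) in n1'; rewrite (Fp_dvd pr2) in n2'.
rewrite (legendre_chi pr1) (legendre_chi pr2).
case: z z0 pp n1 n2 n1' n2' => n z0 pp n1 n2 n1' n2'.
  by apply: chi_nat_periodic => //; rewrite lt0n.
have two1 := Fp_two_neq0 pr1 o1; have two2 := Fp_two_neq0 pr2 o2.
rewrite NegzE !rmorphN /= in n1' n2' *; rewrite oppr_eq0 in n1'; rewrite oppr_eq0 in n2'.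
rewrite -[X in chi X]mulN1r -[X in _ = chi X]mulN1r !chiM // !chi_opp1 //.
congr (_ * _); last by apply: chi_nat_periodic.
rewrite -signr_odd -[RHS]signr_odd; congr ((-1) ^+ nat_of_bool _).
have p4 : p1 = p2 %[mod 4] by apply: eqn_mod_dvdr pp; rewrite dvdn_mulr.
exact: odd_half_mod4.
Qed.

(** One modulus serves a whole list of integers and fixes [p] modulo 16 as well. Its divisibility by
    the prime divisors of the nonzero entries allows these primes to be set aside through
    [periodic_away]. *)
Lemma legendre_modulus (zs : seq int) : exists2 M : nat, (0 < M)%N &
  [/\ forall p1 p2, primes_gt3 p1 -> primes_gt3 p2 -> p1 = p2 %[mod M] ->
        p1 = p2 %[mod 16] /\ {in zs, forall z, legendre z p1 = legendre z p2} &
      forall z (p : nat), z \in zs -> z != 0 -> (p %| z)%Z -> (p %| M)%N].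
Proof.
elim: zs => [|z zs [M M0 [per dvd]]]; first by exists 16%N.
have [N N0 perz] := legendre_periodic z.
pose a := if z == 0 then 1%N else `|z|%N.
have a0 : (0 < a)%N by rewrite /a; case: eqVneq => // z0; rewrite absz_gt0.
exists (a * N * M)%N; first by rewrite !muln_gt0 a0 N0 M0.
split=> [p1 p2 D1 D2 pp|y p].
  have ppM : p1 = p2 %[mod M] by apply: eqn_mod_dvdr pp; rewrite dvdn_mull.
  have ppN : p1 = p2 %[mod N].
    by apply: eqn_mod_dvdr pp; rewrite dvdn_mulr // dvdn_mull.
  have [p16 eqs] := per _ _ D1 D2 ppM; split => // y; rewrite inE => /orP[/eqP ->|].
    exact: perz.
  exact: eqs.
rewrite inE => /orP[/eqP ->|yz] y0 py; last by rewrite dvdn_mull // (dvd y).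
by rewrite -mulnA dvdn_mulr // /a (negPf y0).
Qed.

(** A prime dividing [M] is congruent modulo [M] to no other prime. *)
Lemma periodic_away (T : Type) (g : nat -> T) (M : nat) : (0 < M)%N ->
  (forall p1 p2, primes_gt3 p1 -> primes_gt3 p2 -> ~~ (p1 %| M)%N -> ~~ (p2 %| M)%N ->
     p1 = p2 %[mod M] -> g p1 = g p2) ->
  periodic primes_gt3 g.
Proof.
move=> M0 gM; exists M => // p1 p2 D1 D2 pp.
have [pr1 _] := primes_gt3_odd D1; have [pr2 _] := primes_gt3_odd D2.
have [d1|n1] := boolP (p1 %| M)%N; first by rewrite (prime_eq_mod pr1 pr2 d1 pp).
have [d2|n2] := boolP (p2 %| M)%N; first by rewrite (prime_eq_mod pr2 pr1 d2 (esym pp)).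
exact: gM.
Qed.

(** * Products of linear forms *)

Section LinearFactors.

Variable F : finFieldType.
Hypothesis two_neq0 : 2 != 0 :> F.
Variable eps : int.
Hypothesis epsE : eps = 1 \/ eps = -1.

(** The value of [4 N] given by [sign_prodE] for [a x + b], where [ha], [hb] and [h1] stand for
    [chi a], [chi b] and [chi (-1)]. *)
Definition linear_const (q h1 ha hb : int) : int :=
  if ha == 0 then q - q * hb - (1 - hb)
  else if hb == 0 then q + eps * ha * (q - 1) - 1
  else q - eps * ha - (1 - hb) - (1 - eps * (h1 * ha * hb)).

Lemma linear_root (a b x : F) : a != 0 -> (a * x + b == 0) = (x == - b / a).
Proof.
move=> a0; rewrite addr_eq0; apply/eqP/eqP => [<-|->]; first by field.
by field.
Qed.

Lemma chi_root (a b : F) : chi (- b / a) = chi (-1 : F) * chi b * chi a.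
Proof. by rewrite chi_div // mulNr -mulN1r !chiM // mulrA. Qed.

Lemma sign_prod_linear (a b : F) : (a != 0) || (b != 0) ->
  exists N : nat, sign_prod eps (fun x => a * x + b) = (-1) ^+ N /\
    4 * N%:Z = linear_const #|F| (chi (-1 : F)) (chi a) (chi b).
Proof.
move=> ab; have [N [NE N4]] := sign_prodE two_neq0 (fun x => a * x + b) epsE.
exists N; split => //; rewrite {}N4 /linear_const !chi_eq0 mulr0 add0r.
rewrite sum_chi_affine //.
move: ab; have [->|a0] /= := eqVneq a 0 => ab.
  have -> : \sum_x chi x * chi (0 * x + b) = 0.
    transitivity ((\sum_(x : F) chi x) * chi b); last by rewrite sum_chi ?mul0r.
    by rewrite mulr_suml; apply: eq_bigr => x _; rewrite mul0r add0r.
  rewrite big_pred0 => [|x]; last by rewrite mul0r add0r (negPf ab) andbF.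
  by rewrite mulr0 addr0 subr0.
have -> : \sum_x chi x * chi (a * x + b) = chi a * (if b == 0 then #|F|%:Z - 1 else -1).
  have := sum_chi_affineM two_neq0 0 b (a := 1) (c := a).
  rewrite !mul1r mul0r => /(_ a0) <-.
  by apply: eq_bigr => x _; rewrite mul1r addr0.
have [b0|b0] := eqVneq b 0.
  rewrite big_pred0 => [|x]; first by rewrite b0 chi0; ring.
  by rewrite b0 addr0 mulf_eq0 (negPf a0) /= andNb.
rewrite (big_pred1 (- b / a)) => [|x].
  by rewrite chi_root; ring.
rewrite /= linear_root //; case: (eqVneq x (- b / a)) => [->|_]; last by rewrite andbF.
by rewrite mulf_neq0 ?oppr_eq0 ?invr_eq0.
Qed.

(** The value of [chi] that one linear form takes at the root of the other, when that root satisfies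
    [chi x = - eps]. Here [hD] stands for [chi] of the determinant of the two forms. *)
Definition root_factor (ha h1 hb hD : int) : int :=
  if ha == 0 then 1 else if (h1 * hb * ha == - eps) && (hD != 0) then ha * hD else 1.

Lemma prod_at_root (a1 b1 a2 b2 : F) : (a2 != 0) || (b2 != 0) ->
  \prod_(x | [&& chi x == - eps, a1 * x + b1 != 0 & a2 * x + b2 == 0])
     chi (a1 * x + b1) =
  root_factor (chi a2) (chi (-1 : F)) (chi b2) (chi (a2 * b1 - a1 * b2)).
Proof.
move=> ab; rewrite /root_factor !chi_eq0; have [a0|a0] := eqVneq a2 0.
  rewrite a0 eqxx /= in ab.
  by apply: big_pred0 => x; rewrite a0 mul0r add0r (negPf ab) !andbF.
pose x0 := - b2 / a2.
have l0 : a1 * x0 + b1 = (a2 * b1 - a1 * b2) / a2 by rewrite /x0; field.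
have c0 : chi x0 = chi (-1 : F) * chi b2 * chi a2.
  exact: chi_root.
have D0 : (a1 * x0 + b1 != 0) = (a2 * b1 - a1 * b2 != 0).
  by rewrite l0 mulf_eq0 invr_eq0 (negPf a0) orbF.
rewrite -c0 -D0; case: ifP => [/andP[e0 n0]|/negbT ne].
  rewrite (big_pred1 x0) => [|x].
    by rewrite l0 chi_div // chiM // mulrC.
  rewrite /= (linear_root b2 x a0) -/x0; case: (eqVneq x x0) => [->|_]; last by rewrite !andbF.
  by rewrite e0 n0.
apply: big_pred0 => x; rewrite (linear_root b2 x a0) -/x0.
by case: (eqVneq x x0) => [->|_]; rewrite ?andbF // andbT (negPf ne).
Qed.

(** The product for [l1 * l2] skips the roots of both factors, whereas each separate product skips
    only its own; the two extra products restore the missing values. *)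
Lemma sign_prod_mul (l1 l2 : F -> F) :
  sign_prod eps (fun x => l1 x * l2 x)
   * \prod_(x | [&& chi x == - eps, l1 x != 0 & l2 x == 0]) chi (l1 x)
   * \prod_(x | [&& chi x == - eps, l2 x != 0 & l1 x == 0]) chi (l2 x)
  = sign_prod eps l1 * sign_prod eps l2.
Proof.
rewrite /sign_prod [X in X * _ * _ = _]big_mkcond [X in _ * X * _ = _]big_mkcond.
rewrite [X in _ * _ * X = _]big_mkcond [X in _ = X * _]big_mkcond.
rewrite [X in _ = _ * X]big_mkcond -!big_split /=.
apply: eq_bigr => x _; rewrite mulf_eq0 chiM //.
case: (chi x == - eps) => /=; last by rewrite !mulr1.
by case: (l1 x == 0); case: (l2 x == 0); rewrite /= ?mulr1 ?mul1r.
Qed.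

End LinearFactors.


(** The sign [(-1) ^+ N] read off from [4 N]: [N] is even exactly when 8 divides [4 N]. *)
Definition linear_sign (q eps h1 ha hb : int) : int :=
  if (8 %| linear_const eps q h1 ha hb)%Z then 1 else -1.

Lemma linear_sign_mod (q q' eps h1 ha hb : int) : (8 %| q - q')%Z ->
  linear_sign q eps h1 ha hb = linear_sign q' eps h1 ha hb.
Proof.
move=> /dvdzP[r qE]; have -> : q = r * 8 + q' by rewrite -qE subrK.
rewrite /linear_sign /linear_const.
have cong (x y s : int) : x = s * 8 + y -> (8 %| x)%Z = (8 %| y)%Z.
  by move=> ->; rewrite rpredDl // dvdz_mull.
congr (if _ then _ else _); case: ifP => _; last case: ifP => _.
- by apply: (cong _ _ (r - r * hb)); ring.
- by apply: (cong _ _ (r + eps * ha * r)); ring.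
- by apply: (cong _ _ r); ring.
Qed.

Lemma sign_prod_linear_sign (F : finFieldType) (eps : int) (a b : F) :
  2 != 0 :> F -> eps = 1 \/ eps = -1 -> (a != 0) || (b != 0) ->
  sign_prod eps (fun x => a * x + b) =
  linear_sign #|F| eps (chi (-1 : F)) (chi a) (chi b).
Proof.
move=> two0 epsE ab; have [N [-> N4]] := sign_prod_linear two0 epsE ab.
rewrite /linear_sign -N4 -signr_odd.
have -> : (8 %| 4 * N%:Z)%Z = ~~ odd N by lia.
by case: (odd N).
Qed.

Lemma sqr_chi_if (F : finFieldType) (P : bool) (x : F) :
  (P -> x != 0) -> (if P then chi x else 1) * (if P then chi x else 1) = 1.
Proof. by case: P => [/(_ isT) x0|_]; rewrite ?chi_squared ?mulr1. Qed.

(** The correction at [x = -1] in [Pprod_sign_prod], expressed by Legendre symbols. *)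
Definition boundary_factor (eps h1 ha : int) : int :=
  if (h1 == - eps) && (ha != 0) then ha else 1.


Lemma legendre_opp_nat (p n : nat) : prime p ->
  legendre (- n%:R) p = chi (- n%:R : 'F_p).
Proof. by move=> pr; rewrite legendre_chi // rmorphN /= rmorph_nat. Qed.

Lemma Pprod_boundary (p : nat) (a b c : int) : prime p -> odd p ->
  let F := 'F_p in
  Pprod a b c p = sign_prod (chi (-2 : F)) (fun x : F =>
      c%:~R * x ^+ 2 + (b + 2 * c)%:~R * x + (a + b + c)%:~R)
    * boundary_factor (legendre (-2) p) (legendre (-1) p) (legendre a p).
Proof.
move=> pr po F; rewrite -Pprod_sign_prod // -mulrA.
rewrite (legendre_opp_nat 2 pr) (legendre_opp_nat 1 pr) (legendre_chi pr).
rewrite /boundary_factor chi_eq0.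
set corr := (if _ then _ else _); have -> : corr * corr = 1; last by rewrite mulr1.
by apply: sqr_chi_if => /andP[].
Qed.

Lemma Fp_eps p : prime p -> odd p -> chi (-2 : 'F_p) = 1 \/ chi (-2 : 'F_p) = -1.
Proof.
move=> pr po; have : (-2 : 'F_p) != 0 by rewrite oppr_eq0 Fp_two_neq0.
by move=> /chi_cases /orP[] /eqP; [left | right].
Qed.

Definition factored_product (p : nat) (a m n u v : int) : int :=
  let eps := legendre (-2) p in
  let h1 := legendre (-1) p in
  linear_sign p eps h1 (legendre n p) (legendre (m + n) p)
  * linear_sign p eps h1 (legendre v p) (legendre (u + v) p)
  * root_factor eps (legendre v p) h1 (legendre (u + v) p)
      (legendre (v * (m + n) - n * (u + v)) p)
  * root_factor eps (legendre n p) h1 (legendre (m + n) p)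
      (legendre (n * (u + v) - v * (m + n)) p)
  * boundary_factor eps h1 (legendre a p).

Lemma root_factor_sqr (F : finFieldType) (eps h1 hb : int) (x y : F) :
  let r := root_factor eps (chi x) h1 hb (chi y) in r * r = 1.
Proof.
rewrite /= /root_factor !chi_eq0; case: eqVneq => // x0.
by case: ifP => // /andP[_ y0]; rewrite mulrACA !chi_squared.
Qed.

(** The quadratic splits as [(n x + (m + n)) (v x + (u + v))]; the last two hypotheses say that
    neither factor vanishes identically modulo [p]. *)
Lemma Pprod_factored (p : nat) (a b c m n u v : int) : prime p -> odd p ->
  a = m * u -> b = m * v + n * u -> c = n * v ->
  ~~ (p %| n)%Z || ~~ (p %| m + n)%Z -> ~~ (p %| v)%Z || ~~ (p %| u + v)%Z ->
  Pprod a b c p = factored_product p a m n u v.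
Proof.
move=> pr po aE bE cE nm uv; rewrite Pprod_boundary // /factored_product.
congr (_ * _); set F := 'F_p; have two0 := Fp_two_neq0 pr po.
rewrite !(Fp_dvd pr) in nm uv; rewrite (legendre_opp_nat 2 pr) (legendre_opp_nat 1 pr).
rewrite !(legendre_chi pr).
have epsE := Fp_eps pr po; set eps := chi (-2 : F) in epsE *.
have -> : sign_prod eps (fun x : F =>
    c%:~R * x ^+ 2 + (b + 2 * c)%:~R * x + (a + b + c)%:~R) =
  sign_prod eps (fun x : F =>
    (n%:~R * x + (m + n)%:~R) * (v%:~R * x + (u + v)%:~R)).
  have QE (x : F) : c%:~R * x ^+ 2 + (b + 2 * c)%:~R * x + (a + b + c)%:~R =
      (n%:~R * x + (m + n)%:~R) * (v%:~R * x + (u + v)%:~R).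
    by rewrite aE bE cE; ring.
  by rewrite /sign_prod; apply: eq_big => [x|x _]; rewrite QE.
have := sign_prod_mul two0 eps (fun x : F => n%:~R * x + (m + n)%:~R)
  (fun x : F => v%:~R * x + (u + v)%:~R).
rewrite !prod_at_root // !sign_prod_linear_sign // card_Fp //.
rewrite -!rmorphM -!rmorphB /= => E.
set r1 := root_factor _ _ _ _ _ in E *; set r2 := root_factor _ _ _ _ _ in E *.
have r1s : r1 * r1 = 1 by exact: root_factor_sqr.
have r2s : r2 * r2 = 1 by exact: root_factor_sqr.
(* The root factors are signs, hence their own inverses, and can be moved across the equation. *)
rewrite -E -[X in X = _]mulr1 -r2s -[X in X = _]mulr1 -r1s; ring.
Qed.


Lemma Pprod0 p : Pprod 0 0 0 p = 1.
Proof.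
rewrite /Pprod big1 // => j _; apply: big_pred0 => i.
by rewrite /qform !mul0r !addr0 dvdz0.
Qed.

Lemma periodic_factored (a b c m n u v : int) :
  (forall i j : int, qform a b c i j = (m * i + n * j) * (u * i + v * j)) ->
  periodic primes_gt3 (Pprod a b c).
Proof.
move=> H; have aE : a = m * u by have := H 1 0; rewrite /qform; lia.
have cE : c = n * v by have := H 0 1; rewrite /qform; lia.
have bE : b = m * v + n * u.
  by have := H 1 1; rewrite /qform aE cE !expr1n !mulr1; lia.
have zero : (a = 0) -> (b = 0) -> (c = 0) -> periodic primes_gt3 (Pprod a b c).
  by move=> -> -> ->; exists 1%N => // p1 p2 _ _ _; rewrite !Pprod0.
(* If one of the linear forms is zero, then so is the quadratic form, and P(p) is an empty
   product. *)
have [n0|nm] := boolP ((n == 0) && (m + n == 0)).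
  have [n00 m00] : n = 0 /\ m = 0 by lia.
  by apply: zero; rewrite ?aE ?bE ?cE ?n00 ?m00 ?mul0r ?addr0.
have [v0|vu] := boolP ((v == 0) && (u + v == 0)).
  have [v00 u00] : v = 0 /\ u = 0 by lia.
  by apply: zero; rewrite ?aE ?bE ?cE ?v00 ?u00 ?mulr0 ?addr0.
pose zs := [:: -2; -1; a; n; m + n; v; u + v;
  v * (m + n) - n * (u + v); n * (u + v) - v * (m + n)].
have [M M0 [per dvd]] := legendre_modulus zs.
apply: (periodic_away M0) => p1 p2 D1 D2 n1 n2 pp.
have ndvd (p : nat) (x y : int) : ~~ (p %| M)%N -> x \in zs -> y \in zs ->
    ~~ ((x == 0) && (y == 0)) -> ~~ (p %| x)%Z || ~~ (p %| y)%Z.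
  move=> pM xz yz; rewrite -negb_and; apply: contra => /andP[px py].
  apply/andP; split; apply: contraNT pM => z0; [exact: dvd px | exact: dvd py].
have [pr1 o1] := primes_gt3_odd D1; have [pr2 o2] := primes_gt3_odd D2.
rewrite (Pprod_factored pr1 o1 aE bE cE) ?ndvd ?inE ?eqxx ?orbT //.
rewrite (Pprod_factored pr2 o2 aE bE cE) ?ndvd ?inE ?eqxx ?orbT //.
have [p16 leg] := per _ _ D1 D2 pp.
have p8 : (8 %| p1%:Z - p2%:Z)%Z by move: p16; clear; lia.
rewrite /factored_product !leg ?inE ?eqxx ?orbT //.
by rewrite !(linear_sign_mod _ _ _ _ p8).
Qed.

(** * The congruence for P(p) modulo 16 *)

Lemma congruence_const_mod16 (q q' eps h1 h2 hc hs hB hD : int) :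
  (16 %| q - q')%Z -> exists m : int,
  congruence_const q eps h1 h2 hc hs hB hD
  = congruence_const q' eps h1 h2 hc hs hB hD + 16 * m.
Proof.
move=> /dvdzP[r qE]; have -> : q = r * 16 + q' by rewrite -qE subrK.
pose d (b : bool) : int := if b then r else 0.
exists (2 * (r - hc * d (hD == 0)) + eps * (r + h1 * (d (hB == 0) - d (hD == 0)))).
rewrite /congruence_const /d; move: (root_const _ _ _ _ _ _ _) => L.
by case: (hD == 0); case: (hB == 0); rewrite /=; ring.
Qed.

Definition prime_const (a b c : int) (p : nat) : int :=
  congruence_const p (legendre (-2) p) (legendre (-1) p) (legendre 2 p)
    (legendre c p) (legendre (a + b + c) p) (legendre (b + 2 * c) p)
    (legendre (b ^+ 2 - 4 * a * c) p).

Definition prime_sign (a b c : int) (p : nat) : int :=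
  legendre (-2) p * legendre (-1) p * (legendre c p * legendre (a + b + c) p).

(** This is [sign_prod_congruence] over ['F_p] with [s = a + b + c] and [B = b + 2 c], for which
    [B^2 - 4 c s = b^2 - 4 a c]. Reducing the character sum modulo 16 only changes [m]. *)
Lemma Pprod_congruence (a b c : int) (p : nat) (k : nat -> nat) :
  prime p -> odd p -> ~~ (p %| c * (a + b + c))%Z ->
  (4 * c * (a + b + c) * (k p)%:Z = - (b ^+ 2 - 4 * a * c) %[mod p])%Z ->
  exists (N : nat) (m : int),
    Pprod a b c p = (-1) ^+ N
      * boundary_factor (legendre (-2) p) (legendre (-1) p) (legendre a p) /\
    8 * N%:Z + prime_sign a b c p * Sres k p = prime_const a b c p + 16 * m.
Proof.
move=> pr po pcs kE; set s := a + b + c in pcs kE *; set F := 'F_p.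
have two0 := Fp_two_neq0 pr po.
move: pcs; rewrite (Fp_dvd pr) rmorphM /= mulf_eq0 => /norP[c0 s0].
have DE : (b + 2 * c) ^+ 2 - 4 * c * s = b ^+ 2 - 4 * a * c by rewrite /s; ring.
have DF : (b ^+ 2 - 4 * a * c)%:~R =
    (b + 2 * c)%:~R ^+ 2 - 4 * c%:~R * s%:~R :> F by rewrite -DE; ring.
have kF : 4 * c%:~R * s%:~R * (k p)%:R =
    - ((b + 2 * c)%:~R ^+ 2 - 4 * c%:~R * s%:~R) :> F.
  move/eqP: kE; rewrite eqz_mod_dvd (Fp_dvd pr) rmorphB subr_eq0 => /eqP kE.
  by rewrite -DF -rmorphN -kE; ring.
pose S := \sum_(1 <= y < p) legendre (y%:Z * (y%:Z + 1) * (y%:Z + (k p)%:Z)) p.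
have SE : S = \sum_(y : F) chi (y * (y + 1) * (y + (k p)%:R)).
  rewrite [RHS](bigD1 0) //= !mul0r chi0 add0r.
  rewrite /S [LHS](@big_nat_widenl _ _ _ 1 0) //.
  rewrite (big_Fp_nat pr _ (fun j => true && (1 <= j)%N)
    (fun y => legendre (y%:Z * (y%:Z + 1) * (y%:Z + (k p)%:Z)) p)).
  apply: eq_big => [y|y _]; first by rewrite Fp_val_eq0 // lt0n.
  rewrite legendre_chi //; congr chi.
  by rewrite !rmorphM !rmorphD /= -!pmulrn Fp_valK.
have [N [NE [m mE]]] := sign_prod_congruence two0 c0 s0 (Fp_eps pr po) kF SE.
have [r Sr] : exists r : int, S = 16 * r + Sres k p.
  by exists (S %/ 16)%Z; rewrite {1}(divz_eq S 16) mulrC.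
exists N, (m - prime_sign a b c p * r); split; first by rewrite Pprod_boundary // NE.
have : 8 * N%:Z + prime_sign a b c p * S = prime_const a b c p + 16 * m.
  rewrite /prime_sign /prime_const -/s (legendre_opp_nat 2 pr) (legendre_opp_nat 1 pr).
  by rewrite !(legendre_chi pr) mE DF card_Fp.
by rewrite Sr; move: (Sres k p) => t H; rewrite mulrBr addrA -H; ring.
Qed.

(** * Equivalence with the character sum *)

Lemma legendre_sign (z : int) (p : nat) : ~~ (p %| z)%Z ->
  legendre z p = 1 \/ legendre z p = -1.
Proof. by rewrite /legendre => /negPf ->; case: ifP; [left | right]. Qed.

Lemma boundary_factor_sign (eps h1 : int) (z : int) (p : nat) :
  boundary_factor eps h1 (legendre z p) = 1 \/
  boundary_factor eps h1 (legendre z p) = -1.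
Proof.
rewrite /boundary_factor; case: ifP => [/andP[_ z0]|_]; last by left.
apply: legendre_sign; apply: contraNN z0 => pz; by rewrite /legendre pz.
Qed.

Lemma Sres_range (k : nat -> nat) (p : nat) : 0 <= Sres k p < 16.
Proof. by rewrite /Sres modz_ge0 // ltz_pmod. Qed.

Lemma interpolate (x0 y0 d : rat) : d != 0 -> y0 != 0 ->
  exists2 f : {poly rat}, size f = 2%N & f.[x0] = y0 /\ f.[x0 + d] = - y0.
Proof.
move=> d0 y0n; exists ((- 2 * y0 / d)%:P * 'X + (y0 + 2 * y0 / d * x0)%:P).
  have c0 : - 2 * y0 / d != 0 by rewrite !mulf_neq0 ?invr_eq0.
  by rewrite size_MXaddC polyC_eq0 (negPf c0) /= size_polyC c0.
by split; rewrite hornerMXaddC hornerC; field.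
Qed.

(** Compare each prime [p] of a class with a fixed one, [p0]. All Legendre symbols agree, so the
    congruence forces [8 (N - N0)] to be plus or minus [Sres k p - Sres k p0] modulo 16. Thus P
    keeps its value when the residues agree and changes sign when they differ by 8, and a line
    through these two points computes P. *)
Lemma equivalent_Pprod_Sres (a b c : int) (k : nat -> nat) :
  (forall p : nat, primes_gt3_ndvd (c * (a + b + c)) p ->
    (4 * c * (a + b + c) * (k p)%:Z = - (b ^+ 2 - 4 * a * c) %[mod p])%Z) ->
  equivalent primes_gt3 (Pprod a b c)
             (primes_gt3_ndvd (c * (a + b + c))) (Sres k).
Proof.
move=> kE; set s := a + b + c in kE *.
pose zs := [:: -2; -1; 2; a; c; s; b + 2 * c; b ^+ 2 - 4 * a * c].
have [M M0 [per _]] := legendre_modulus zs.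
(* The factor 2 ensures a modulus greater than 1. *)
exists (2 * M)%N => [|r _ _]; first by lia.
(* For a class without primes of the domain, any polynomial of degree one will do. *)
have [[p0 [D0 p0r]]|none] := classic
    (exists p0, primes_gt3_ndvd (c * s) p0 /\ p0 = r %[mod 2 * M]); last first.
  exists 'X; first by rewrite size_polyX.
  by move=> p _ Dp pr; case: none; exists p.
have [G0 n0] := andP D0; have [pr0 o0] := primes_gt3_odd G0.
have [N0 [m0 [P0 E0]]] := Pprod_congruence pr0 o0 n0 (kE _ D0).
have sgn : prime_sign a b c p0 = 1 \/ prime_sign a b c p0 = -1.
  rewrite /prime_sign (legendre_opp_nat 2 pr0) (legendre_opp_nat 1 pr0).
  have one0 : (-1 : 'F_p0) != 0 by rewrite oppr_eq0 oner_neq0.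
  have cN : ~~ (p0 %| c)%Z by apply: contra n0 => /dvdz_mulr.
  have sN : ~~ (p0 %| s)%Z by apply: contra n0 => /dvdz_mull.
  have /orP[] := chi_cases one0 => /eqP ->; case: (Fp_eps pr0 o0) => ->;
    case: (legendre_sign cN) => ->; case: (legendre_sign sN) => ->; by auto.
(* The sign of [d] keeps [Sres k p0 + d] between 0 and 15, so it is the only other residue that can
   occur. *)
pose d : int := if Sres k p0 < 8 then 8 else -8.
have [f sf [f0 f1]] : exists2 f : {poly rat}, size f = 2%N &
    f.[(Sres k p0)%:~R] = (Pprod a b c p0)%:~R /\
    f.[(Sres k p0)%:~R + d%:~R] = - (Pprod a b c p0)%:~R.
  apply: interpolate; first by rewrite /d; case: ifP.
  rewrite intr_eq0 P0 mulf_neq0 ?signr_eq0 //.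
  by case: (boundary_factor_sign (legendre (-2) p0) (legendre (-1) p0) a p0) => ->.
exists f => // p G D ppr.
have [_ n1] := andP D; have [pr o] := primes_gt3_odd G.
have [N [m [P E]]] := Pprod_congruence pr o n1 (kE _ D).
have pp : p = p0 %[mod M].
  by apply: (@eqn_mod_dvdr _ (2 * M)); rewrite ?dvdn_mull // ppr.
have [p16 leg] := per _ _ G G0 pp.
have signE : prime_sign a b c p = prime_sign a b c p0.
  by rewrite /prime_sign !leg ?inE ?eqxx ?orbT.
have [m' constE] : exists m', prime_const a b c p = prime_const a b c p0 + 16 * m'.
  rewrite /prime_const !leg ?inE ?eqxx ?orbT //; apply: congruence_const_mod16.
  by move: p16; clear; lia.
have bE : boundary_factor (legendre (-2) p) (legendre (-1) p) (legendre a p) =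
    boundary_factor (legendre (-2) p0) (legendre (-1) p0) (legendre a p0).
  by rewrite !leg ?inE ?eqxx ?orbT.
have Sr0 := Sres_range k p0; have Sr := Sres_range k p.
have cases : Sres k p = Sres k p0 /\ odd N = odd N0 \/
             Sres k p = Sres k p0 + d /\ odd N = ~~ odd N0.
  move: E E0; rewrite signE constE /d.
  move: (prime_const _ _ _ _) (Sres k p) (Sres k p0) Sr Sr0 => K S S0 Sr Sr0.
  move: Sr Sr0 => /andP[Sl Su] /andP[Sl0 Su0].
  case: sgn => ->; clear -Sl Su Sl0 Su0; by case: ifP => S8 E E0; lia.
have PE : Pprod a b c p = (-1) ^+ (odd N (+) odd N0) * Pprod a b c p0.
  rewrite P P0 bE signr_addb !signr_odd mulrA; congr (_ * _).
  by rewrite -mulrA -exprD addnn -[_ ^+ _.*2]signr_odd odd_double mulr1.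
case: cases => -[-> oE]; rewrite PE oE.
  by rewrite addbb mul1r f0.
by rewrite addNb addbb /= expr1 mulN1r rmorphN /= rmorphD /= f1.
Qed.

Theorem theorem2p3 (a b c : int) :
  let Delta := b ^+ 2 - 4 * a * c in
  let sigma := a + b + c in
  (forall k : nat -> nat,
     (forall p : nat, primes_gt3_ndvd (c * sigma) p ->
        is_least_positive
          (fun l : nat => (4 * c * sigma * l%:Z = - Delta %[mod p])%Z) (k p)) ->
     equivalent primes_gt3 (Pprod a b c)
                (primes_gt3_ndvd (c * sigma)) (Sres k))
  /\
  (forall m n u v : int,
     (forall i j : int,
        qform a b c i j = (m * i + n * j) * (u * i + v * j)) ->
     periodic primes_gt3 (Pprod a b c)).
Proof.
split=> [k kE|m n u v]; last exact: periodic_factored.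
by apply: equivalent_Pprod_Sres => p /kE[].
Qed.
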